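(* There are infinitely many (quadratic) number fields that contain orders with trivial Chow group. That is, there are infinitely many quadratic number fields $K$ for which there exists an order $\mathcal{O}$ in $K$ such that $\mathrm{Chow}(\mathcal{O})$ is trivial.
   Context: An order in a number field $K$ is a subring of $K$ which is finitely generated as a $\mathbb{Z}$-module and contains a $\mathbb{Q}$-basis of $K$. For an order $\mathcal{O}$ in $K$, let $\mathbb{P}(\mathcal{O})$ be its set of maximal ideals. For $\mathfrak{p}\in\mathbb{P}(\mathcal{O})$ let $\mathcal{O}_\mathfrak{p}$ be the localization and $\mathrm{ord}_\mathfrak{p}\colon K^*\to\mathbb{Z}$ the well-defined homomorphism $\frac{a}{b}\mapsto\mathrm{len}_{\mathcal{O}_\mathfrak{p}}(\mathcal{O}_\mathfrak{p}/a\mathcal{O}_\mathfrak{p})-\mathrm{len}_{\mathcal{O}_\mathfrak{p}}(\mathcal{O}_\mathfrak{p}/b\mathcal{O}_\mathfrak{p})$ (nonzero $a,b\in\mathcal{O}$), where $\mathrm{len}$ is composition length. $\mathrm{Div}(\mathcal{O})$ is the free abelian group on $\mathbb{P}(\mathcal{O})$, $\mathcal{P}(\mathcal{O})$ is the image of $K^*\to\mathrm{Div}(\mathcal{O})$, $a\mapsto\sum_\mathfrak{p}\mathrm{ord}_\mathfrak{p}(a)\mathfrak{p}$, and $\mathrm{Chow}(\mathcal{O})=\mathrm{Div}(\mathcal{O})/\mathcal{P}(\mathcal{O})$. *)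

(* Defs.v *)
From HB Require Import structures.
From mathcomp Require Import all_boot all_order all_algebra all_field.
From mathcomp Require Import boolp classical_sets fsbigop.
From mathcomp Require Import freeg.

Set Implicit Arguments.
Unset Strict Implicit.
Unset Printing Implicit Defensive.

Import GRing.Theory.
Local Open Scope ring_scope.
Local Open Scope classical_set_scope.

Section Length.
Variables (R : pzRingType) (M : lmodType R).

(* [N] is a maximal proper submodule of [N'], i.e. [N' / N] is simple. *)
Definition maximal_in (N N' : {pred M}) : Prop :=
  [/\ {subset N <= N'}, ~ {subset N' <= N} &
      forall L : {pred M}, submod_closed L ->
        {subset N <= L} -> {subset L <= N'} -> L =i N \/ L =i N'].

Definition composition_series (n : nat) (F : nat -> {pred M}) : Prop :=
  [/\ forall i, (i <= n)%N -> submod_closed (F i),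
      F 0%N =i pred1 0, F n =i predT &
      forall i, (i < n)%N -> maximal_in (F i) (F i.+1)].

(* Composition length of [M]; junk value 0 if there is no composition series.
   By Jordan-Hölder all composition series have the same length. *)
Definition mod_length : nat :=
  xget 0%N [set n | exists F, composition_series n F].

End Length.

Record submodule (R : pzRingType) (M : lmodType R) := Submodule {
  submod_pred :> {pred M};
  submodP : submod_closed submod_pred }.

HB.instance Definition _ (R : pzRingType) (M : lmodType R) (N : submodule M) :=
  GRing.isSubmodClosed.Build R M (submod_pred N) (submodP N).

Section QuotientModule.
Variables (R : pzRingType) (M : lmodType R) (N : submodule M).

Definition quotmod : Type := Quotient.quot (submod_pred N).
HB.instance Definition _ := GRing.Zmodule.on quotmod.

Definition quotmod_pi : M -> quotmod :=
  \pi_(Quotient.quot (submod_pred N))%qT.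

Definition quotmod_scale (a : R) (x : quotmod) : quotmod :=
  quotmod_pi (a *: repr x).

Lemma quotmod_piD : {morph quotmod_pi : x y / x + y}.
Proof. by move=> x y; rewrite /quotmod_pi raddfD. Qed.

Lemma quotmod_piK (x : quotmod) : quotmod_pi (repr x) = x.
Proof. exact: reprK. Qed.

Lemma quotmod_scale_pi a (x : M) :
  quotmod_scale a (quotmod_pi x) = quotmod_pi (a *: x).
Proof.
apply/eqP; rewrite -Quotient.idealrBE -scalerBr rpredZ //.
by rewrite Quotient.idealrBE reprK.
Qed.

Fact quotmod_scaleA a b x :
  quotmod_scale a (quotmod_scale b x) = quotmod_scale (a * b) x.
Proof. by rewrite [quotmod_scale b x]/quotmod_scale quotmod_scale_pi scalerA. Qed.

Fact quotmod_scale1 : left_id 1 quotmod_scale.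
Proof. by move=> x; rewrite /quotmod_scale scale1r quotmod_piK. Qed.

Fact quotmod_scaleDr : right_distributive quotmod_scale +%R.
Proof.
move=> a x y; rewrite -[x]quotmod_piK -[y]quotmod_piK -quotmod_piD.
by rewrite !quotmod_scale_pi scalerDr quotmod_piD.
Qed.

Fact quotmod_scaleDl x : {morph quotmod_scale^~ x : a b / a + b}.
Proof. by move=> a b; rewrite /quotmod_scale scalerDl quotmod_piD. Qed.

HB.instance Definition _ := GRing.Zmodule_isLmodule.Build R quotmod
  quotmod_scaleA quotmod_scale1 quotmod_scaleDr quotmod_scaleDl.

End QuotientModule.

Section MaximalIdeals.
Variable R : comNzRingType.

(* [idealr_closed] includes properness. The predicate is stored as a plain
   function and only then coerced to [{pred R}]: a field of type [{pred R}]
   would put the record in too large a universe to be a [choiceType]. *)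
Record maximal_ideal := MaximalIdeal {
  maxideal_pred : R -> bool;
  maxideal_ideal : idealr_closed maxideal_pred;
  maxideal_max : forall I : {pred R}, idealr_closed I ->
    {subset maxideal_pred <= I} -> {subset I <= maxideal_pred} }.

Definition mem_maxideal (m : maximal_ideal) : {pred R} := maxideal_pred m.
Coercion mem_maxideal : maximal_ideal >-> pred_sort.

HB.instance Definition _ := gen_eqMixin maximal_ideal.
HB.instance Definition _ := gen_choiceMixin maximal_ideal.

Lemma maximal_ideal_prime (m : maximal_ideal) (s t : R) :
  s \notin m -> t \notin m -> s * t \notin m.
Proof.
move=> sm tm; have [m0 m1 mD] := maxideal_ideal m.
apply/negP => stm; pose I : {pred R} :=
  fun x => `[< exists r u, u \in m /\ x = r * s + u >].
have I1 : 1 \notin I.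
  apply/negP => /asboolP [r [u [um e]]]; case/negP: tm.
  rewrite -[t]mul1r e mulrDl -mulrA (mulrC u) mD // -[t * u]addr0.
  exact: mD.
have Iid : idealr_closed I.
  split=> // [|a x y /asboolP [r [u [um ->]]] /asboolP [r' [u' [um' ->]]]].
    by apply/asboolP; exists 0, 0; rewrite mul0r addr0.
  apply/asboolP; exists (a * r + r'), (a * u + u'); split; first exact: mD.
  by rewrite mulrDr mulrDl !mulrA addrACA.
case/negP: sm; apply: (maxideal_max Iid) => [x xm|]; apply/asboolP.
  by exists 0, x; rewrite mul0r add0r.
by exists 1, 0; rewrite mul1r addr0.
Qed.

End MaximalIdeals.

Section Subrings.
Variables (K : fieldType) (S : subringClosed K).

Definition subring_of : Type := {x : K | x \in S}.
HB.instance Definition _ := SubChoice.on subring_of.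
HB.instance Definition _ := [SubChoice_isSubComNzRing of subring_of by <:].

End Subrings.

Section Localization.
Variables (K : fieldType) (S : subringClosed K).
Variable p : maximal_ideal (subring_of S).

(* The localization at [p] as the subring of [K] of the fractions [a / s]. *)
Definition loc_pred : {pred K} := fun x =>
  `[< exists a s : subring_of S, s \notin p /\ x = val a / val s >].

Fact loc_subring_closed : subring_closed loc_pred.
Proof.
have [p0 p1 _] := maxideal_ideal p.
have nz (s : subring_of S) : s \notin p -> val s != 0.
  by apply: contraNneq => s0; rewrite (_ : s = 0) //; apply: val_inj.
split.
- by apply/asboolP; exists 1, 1; rewrite divr1.
- move=> _ _ /asboolP [a [s [sp ->]]] /asboolP [b [t [tp ->]]].
  apply/asboolP; exists (a * t - b * s), (s * t).
  split; first exact: maximal_ideal_prime.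
  by rewrite /= -mulNr addf_div ?nz // mulNr.
- move=> _ _ /asboolP [a [s [sp ->]]] /asboolP [b [t [tp ->]]].
  apply/asboolP; exists (a * b), (s * t).
  split; first exact: maximal_ideal_prime.
  by rewrite /= mulf_div.
Qed.

HB.instance Definition _ :=
  GRing.isSubringClosed.Build K loc_pred loc_subring_closed.

Definition localization : Type := subring_of loc_pred.
HB.instance Definition _ := GRing.ComNzRing.on localization.

Fact to_loc_subproof (a : subring_of S) : val a \in loc_pred.
Proof.
have [_ p1 _] := maxideal_ideal p.
by apply/asboolP; exists a, 1; rewrite divr1.
Qed.

Definition to_loc (a : subring_of S) : localization :=
  exist _ (val a) (to_loc_subproof a).

End Localization.

Section PrincipalSubmodule.
Variables (R : comNzRingType) (a : R).

Definition principal_pred : {pred R^o} := fun x => `[< exists r, x = r * a >].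

Fact principal_submod_closed : submod_closed principal_pred.
Proof.
split; first by apply/asboolP; exists 0; rewrite mul0r.
move=> r _ _ /asboolP [x ->] /asboolP [y ->]; apply/asboolP.
by exists (r * x + y); rewrite mulrDl -mulrA.
Qed.

Definition principal_submodule : submodule R^o :=
  Submodule principal_submod_closed.

End PrincipalSubmodule.

Section Orders.
Variable K : fieldExtType rat.

Definition is_order (S : {pred K}) : Prop :=
  [/\ subring_closed S,
      exists n (g : n.-tuple K), forall x, x \in S <-> inIntSpan g x &
      exists2 b : seq K, basis_of {:K} b & {subset b <= S}].

Record nf_order := Order {
  order_pred :> {pred K};
  orderP : is_order order_pred }.

Fact order_subring_closed (O : nf_order) : subring_closed O.
Proof. by case: (orderP O). Qed.

HB.instance Definition _ (O : nf_order) :=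
  GRing.isSubringClosed.Build K (order_pred O) (order_subring_closed O).

Variable O : nf_order.
Local Notation OR := (subring_of (order_pred O)).

Definition spec_max := maximal_ideal OR.
HB.instance Definition _ := Choice.on spec_max.

Definition local_length (p : spec_max) (a : OR) : nat :=
  mod_length (quotmod (principal_submodule (to_loc p a))).

(* The value does not depend on the fraction [a / b] representing [x]; it is
   meant for [x != 0] (in particular [ord_at p 0 = 0] is a junk value). *)
Definition ord_at (p : spec_max) (x : K) : int :=
  xget 0 [set z | exists a b : OR,
    [/\ a != 0, b != 0, x = val a / val b &
        z = (local_length p a)%:Z - (local_length p b)%:Z]].

Definition Div : Type := {freeg spec_max / int}.
HB.instance Definition _ := GRing.Zmodule.on Div.

(* For [x != 0] only finitely many terms are nonzero, so that the [fsbigop] sum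
   is the sum over all maximal ideals. *)
Definition divisor (x : K) : Div :=
  \sum_(p \in [set: spec_max]) (<< ord_at p x *g p >> : Div).

Definition principal_divisors : set Div := divisor @` [set x | x != 0].

Definition chow_coset (D : Div) : set Div :=
  [set D + E | E in principal_divisors].

(* The quotient [Div / principal_divisors] as its set of cosets; as a group it
   is trivial when the coset of 0 is its only element. *)
Definition Chow : set (set Div) := chow_coset @` setT.

Definition Chow_trivial : Prop := Chow = [set chow_coset 0].

End Orders.

Arguments nf_order K : clear implicits.
Arguments principal_divisors {K} O _.
Arguments Chow {K} O _.

(* A field morphism between extensions of [rat] is automatically [rat]-linear. *)
Definition field_isomorphic (K L : fieldType) : Prop :=
  exists f : {rmorphism K -> L}, bijective f.

(* Main.v *)
From HB Require Import structures.
From mathcomp Require Import all_boot all_order all_algebra all_field.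
From mathcomp Require Import boolp classical_sets functions cardinality fsbigop.
From mathcomp Require Import freeg.
From mathcomp Require Import zify ring lra.
Require Import Defs.

Set Implicit Arguments.
Unset Strict Implicit.
Unset Printing Implicit Defensive.

Import Order.TTheory GRing.Theory Num.Theory.
Local Open Scope ring_scope.
Local Open Scope classical_set_scope.

(** Let p = 4e - 1 be prime, K = Q(w) with w^2 = w - e, so that K has
    discriminant -p and Z[w] is its maximal order, with norm form
    N(x + y w) = x^2 + x y + e y^2.  Let f be the product of the primes below p
    that split in K.  The order O = Z + f w Z has trivial Chow group; as p runs
    over the primes congruent to 3 mod 4 this gives infinitely many fields.

    The reason is that Chow(O) is a quotient of the class group of K: if q
    divides f, both primes of Z[w] above q map to the only prime of O above q.
    Their two classes are inverse to each other, so the quotient kills the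
    squares of these classes.  The primes dividing f generate the class group,
    which has odd order since only one prime ramifies.  The proof makes each of
    these points explicit with elements of K.

    Singular primes, q | f.  The prime Q over q satisfies div(q) = 2 Q
    (singular_length).  Conjugation preserves Q, so an element of norm q^k has
    order k at Q, and order 0 elsewhere (ord_norm).  An odd k exists
    (odd_norm_exists): comparing short vectors in powers of a prime above q
    yields, by the pigeonhole principle, an element whose norm is a power of q
    and which is not a power of q up to a unit; the classical descent of genus
    theory (genus_step) halves the exponent until it is odd.  Hence Q is
    principal (singular_principal).

    Other primes, by induction on the rational prime l that they contain
    (prime_principal).  If l is inert, P = l O.  Otherwise l >= p, and P contains
    f (r + w) with 0 <= r < l.  Since N(r + w) = r^2 + r + e < l^2, the divisor of
    f (r + w) is P plus primes that contain f or a rational prime smaller than l,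
    all of them principal.

    Orders are measured by composition lengths over the localizations O_P.
    These are computed with chains of O_P-submodules of K, for which
    Jordan-Hoelder (chain_uniq), multiplicativity (has_lengthM) and invariance
    under conjugation (has_length_conj) have direct proofs. *)

(** * Norms from an imaginary quadratic field of prime discriminant *)

Section SquareProducts.
Local Open Scope nat_scope.

(** After division by g = gcd(a, b) the factors are coprime with a square
    product, so each is the square of its gcd with the square root. *)
Lemma mul_eq_square (a b c : nat) : 0 < a -> a * b = c ^ 2 ->
  exists g s t, [/\ a = g * s ^ 2, b = g * t ^ 2 & c = g * s * t].
Proof.
move=> a0 abc; set g := gcdn a b.
have g0 : 0 < g by rewrite gcdn_gt0 a0.
have [a1 aE] := dvdnP (dvdn_gcdl a b); have [b1 bE] := dvdnP (dvdn_gcdr a b).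
rewrite -/g in aE bE.
have cop : coprime a1 b1.
  by rewrite /coprime -(eqn_pmul2r g0) mul1n muln_gcdl -aE -bE.
have [c1 cE] : exists c1, c = c1 * g.
  apply/dvdnP; rewrite -(@dvdn_pexp2r _ _ 2) // -abc aE bE.
  by rewrite mulnACA dvdn_mull.
have abc1 : a1 * b1 = c1 ^ 2.
  apply/eqP; rewrite -(eqn_pmul2r (_ : 0 < g ^ 2)) ?expn_gt0 ?g0 //.
  by rewrite -expnMn -cE -abc aE bE mulnACA.
have a10 : 0 < a1 by move: a0; rewrite aE muln_gt0 => /andP[].
pose s := gcdn a1 c1; have s0 : 0 < s by rewrite gcdn_gt0 a10.
have [a2 a1E] := dvdnP (dvdn_gcdl a1 c1); have [t c1E] := dvdnP (dvdn_gcdr a1 c1).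
rewrite -/s in a1E c1E.
have cop2 : coprime a2 t.
  by rewrite /coprime -(eqn_pmul2r s0) mul1n muln_gcdl -a1E -c1E.
have h : a2 * b1 = s * t ^ 2.
  by apply/eqP; rewrite -(eqn_pmul2r s0); apply/eqP; rewrite mulnAC -a1E abc1 c1E; lia.
have a2s : a2 %| s.
  by rewrite -(@Gauss_dvdl _ _ (t ^ 2)) ?coprimeXr // -h dvdn_mulr.
have sa2 : s %| a2.
  rewrite -(@Gauss_dvdl _ _ b1); first by rewrite h dvdn_mulr.
  by apply: coprime_dvdl cop; apply: dvdn_gcdl.
have e2 : a2 = s by apply/eqP; rewrite eqn_dvd a2s.
have eb : b1 = t ^ 2.
  by apply/eqP; rewrite -(eqn_pmul2l s0) -h e2.
exists g, s, t; split; first by rewrite aE a1E e2; lia.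
  by rewrite bE eb mulnC.
by rewrite cE c1E; lia.
Qed.

End SquareProducts.

(** The norm of x + y w, where w is a root of X^2 - X + e. *)
Definition qnorm (e x y : int) : int := x * x + x * y + e * (y * y).

Lemma absz_sqr (a : int) : (`|a| * `|a|)%N%:Z = a * a.
Proof. by rewrite PoszM !abszE -normrM ger0_norm // -expr2 sqr_ge0. Qed.

Section Genus.
Variables (p e : nat).
Hypothesis pE : (p.+1 = 4 * e)%N.
Hypothesis p_pr : prime p.
Local Notation N := (qnorm e%:Z).

(** Completing the square, with p = 4e - 1; definiteness and the parity
    arguments on norms come from this form. *)
Lemma qnorm4 x y : 4 * N x y = (2 * x + y) * (2 * x + y) + p%:Z * (y * y).
Proof.
have -> : p%:Z = 4 * e%:Z - 1 by lia.
by rewrite /qnorm; ring.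
Qed.

Lemma qnorm_ge0 x y : 0 <= N x y.
Proof.
rewrite -(@pmulr_rge0 _ 4) // qnorm4 addr_ge0 -?expr2 ?sqr_ge0 //.
by rewrite mulr_ge0 // sqr_ge0.
Qed.

Lemma p_gt0 : (0 < p)%N. Proof. exact: prime_gt0. Qed.

Lemma qnorm_gt0 x y : (x != 0) || (y != 0) -> 0 < N x y.
Proof.
move=> h; rewrite lt_neqAle qnorm_ge0 andbT; apply: contraTneq h => N0.
have := qnorm4 x y; rewrite -N0 mulr0 -!expr2 => /esym/eqP.
have h2 : 0 <= p%:Z * y ^+ 2 by rewrite mulr_ge0 // sqr_ge0.
rewrite (paddr_eq0 (sqr_ge0 _) h2) sqrf_eq0 mulf_eq0 sqrf_eq0.
have -> : (p%:Z == 0) = false by have := p_gt0; lia.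
by move=> /andP[h1 /eqP y0]; move: h1; rewrite y0; lia.
Qed.

Lemma p_odd : odd p.
Proof. by have := congr1 odd pE; rewrite oddM /=; case: odd. Qed.

Section Prime.
Variable q : nat.
Hypothesis q_pr : prime q.

(** Only p ramifies, so an element of norm q^(2m) that q does not divide is a
    square up to sign.  Concretely, put n = q^m and A = 2x + y: then
    (2n - A)(2n + A) = p y^2, and p divides one of the factors, so the two are
    g s^2 and p g t^2 in some order, with sum 4n.  Here g divides y, hence is
    prime to q and divides 4; the value g = 2 contradicts p = 3 mod 4, and for
    g = 1 or 4 the pair (s, t) yields an element of norm n. *)
Lemma genus_step m x y : ~~ (q %| `|y|)%N -> N x y = (q ^ (2 * m))%N%:Z ->
  exists x' y', ~~ (q %| `|y'|)%N /\ N x' y' = (q ^ m)%N%:Z.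
Proof.
move=> qy Nxy.
have := qnorm4 x y; rewrite Nxy => e4.
pose n := (q ^ m)%N; pose A := absz (2 * x + y); pose Y := `|y|%N.
have n0 : (0 < n)%N by rewrite expn_gt0 prime_gt0.
have Y0 : (0 < Y)%N by rewrite lt0n; apply: contraNneq qy; rewrite -/Y => ->.
have p0 := p_gt0.
have enat : (4 * (n * n) = A * A + p * (Y * Y))%N.
  have : (q ^ (2 * m) = n * n)%N by rewrite mul2n -addnn expnD.
  move=> en; rewrite en -!absz_sqr -/A -/Y in e4; lia.
have An : (A < 2 * n)%N.
  have : (0 < p * (Y * Y))%N by rewrite !muln_gt0 p0 Y0.
  move=> h; rewrite ltnNge; apply/negP => h'.
  have := leq_mul h' h'; lia.
pose u := (2 * n - A)%N; pose w := (2 * n + A)%N.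
have uw : (u * w = p * Y ^ 2)%N.
  by rewrite /u /w -subn_sqr -!mulnn; move: enat; clear; lia.
have [g [s [t [gst qg qt]]]] : exists g s t, [/\ (g * (s ^ 2 + p * t ^ 2) = 4 * n)%N,
    (g %| Y)%N & ~~ (q %| t)%N].
  have : (p %| u * w)%N by rewrite uw dvdn_mulr.
  rewrite Euclid_dvdM // => /orP[] /dvdnP [v vE].
  - have : (w * v = Y ^ 2)%N.
      by apply/eqP; rewrite -(eqn_pmul2l p0) -uw vE; apply/eqP; lia.
    have w0 : (0 < w)%N by rewrite /w; lia.
    case/(mul_eq_square w0) => g [s [t [h1 h2 h3]]]; exists g, s, t; split.
    + have -> : (4 * n = w + u)%N by rewrite /u /w; lia.
      by rewrite vE h2 h1; lia.
    + by rewrite h3 -mulnA dvdn_mulr.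
    + by apply: contra qy; rewrite -/Y h3 => h; rewrite dvdn_mull.
  - have : (u * v = Y ^ 2)%N.
      by apply/eqP; rewrite -(eqn_pmul2l p0) -uw vE; apply/eqP; lia.
    have u0 : (0 < u)%N by rewrite /u; lia.
    case/(mul_eq_square u0) => g [s [t [h1 h2 h3]]]; exists g, s, t; split.
    + have -> : (4 * n = u + w)%N by rewrite /u /w; lia.
      by rewrite vE h2 h1; lia.
    + by rewrite h3 -mulnA dvdn_mulr.
    + by apply: contra qy; rewrite -/Y h3 => h; rewrite dvdn_mull.
have qNg : ~~ (q %| g)%N by apply: contra qy => h; apply: dvdn_trans qg.
have g4 : (g %| 4)%N.
  rewrite -(@Gauss_dvdl _ _ n) -?gst ?dvdn_mulr //.
  by rewrite coprime_sym /n coprimeXl // prime_coprime.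
have: g \in divisors 4 by rewrite -dvdn_divisors.
rewrite !inE => /or3P[] /eqP gE; rewrite gE -!mulnn in gst qNg.
- have [z zE] : exists z : nat, (s + t = 2 * z)%N.
    exists ((s + t)./2)%N; rewrite mul2n halfK.
    suff -> : odd (s + t) = false by rewrite subn0.
    have := congr1 odd gst; rewrite mul1n !oddD !oddM p_odd /=.
    by case: (odd s); case: (odd t); case: (odd n).
  exists (z%:Z - t%:Z), t%:Z; split; first by rewrite absz_nat.
  have := qnorm4 (z%:Z - t%:Z) t%:Z.
  have -> : 2 * (z%:Z - t%:Z) + t%:Z = s%:Z by clear -zE; lia.
  by clear -gst; rewrite -/n; lia.
(* g = 2: here n is odd, while s^2 + p t^2 is never 2 mod 4. *)
- exfalso; have q2 : odd q by case: (even_prime q_pr) qNg => [->|].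
  have n2 : odd n by rewrite /n oddX q2 orbT.
  have gst' : (s * s + p * (t * t) = 2 * n)%N by clear -gst; lia.
  have st : odd t = odd s.
    have := congr1 odd gst'; rewrite oddD !oddM p_odd /=.
    by case: (odd s); case: (odd t); case: (odd n).
  have := odd_double_half s; have := odd_double_half t; rewrite st -!mul2n.
  move: (s./2) (t./2) => s' t' tE sE; move: gst'; rewrite -sE -tE.
  have -> : p = (4 * e - 1)%N by clear -pE; lia.
  have := odd_double_half n; rewrite n2 -mul2n; move: (n./2) => n' <-.
  have [e' ->] : exists e', e = e'.+1 by exists e.-1; clear -pE; lia.
  case: (odd s) => /= h.
    have : (4 * (s' * s' + s' + (4 * e'.+1 - 1) * (t' * t' + t') + e'.+1) = 4 * n' + 2)%N.
      by clear -h; lia.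
    by clear; lia.
  have : (4 * (s' * s' + (4 * e'.+1 - 1) * (t' * t')) = 4 * n' + 2)%N by clear -h; lia.
  by clear; lia.
have q2 : odd q by case: (even_prime q_pr) qNg => [->|].
exists (s%:Z - t%:Z), (2 * t%:Z); split.
  rewrite abszM Euclid_dvdM // negb_or absz_nat qt andbT.
  by apply: contraL q2; rewrite /= dvdn_prime2 // => /eqP ->.
have := qnorm4 (s%:Z - t%:Z) (2 * t%:Z).
have -> : 2 * (s%:Z - t%:Z) + 2 * t%:Z = 2 * s%:Z by clear; lia.
by clear -gst; rewrite -/n; lia.
Qed.

Definition odd_norm : Prop := exists k x y, odd k /\ N x y = (q ^ k)%N%:Z.

(** The genus step halves an even exponent and keeps the second coordinate
    prime to q, so it can be repeated until the exponent is odd. *)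
Lemma primitive_odd_norm k x y : (0 < k)%N -> ~~ (q %| `|y|)%N ->
  N x y = (q ^ k)%N%:Z -> odd_norm.
Proof.
elim/ltn_ind: k x y => k IH x y k0 qy Nxy.
have [ok|ek] := boolP (odd k); first by exists k, x, y.
have kE : k = (2 * k./2)%N by rewrite mul2n even_halfK.
rewrite kE in Nxy; have [x' [y' [qy' Nxy']]] := genus_step qy Nxy.
by apply: (IH k./2) Nxy' => //; clear -k0 kE; lia.
Qed.

Lemma dvdz_sqr (a : int) : (q %| a * a)%Z = (q %| a)%Z.
Proof. by rewrite !dvdzE abszM Euclid_dvdM // orbb. Qed.

(** Divide by q as long as possible.  If this stops before the exponent is
    exhausted, the quotient is primitive and the descent applies; otherwise
    x + y w is q^n times an element of norm 1. *)
Lemma odd_norm_or_dvd n x y : N x y = (q ^ (2 * n))%N%:Z ->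
  odd_norm \/ exists x' y', x = (q ^ n)%N%:Z * x' /\ y = (q ^ n)%N%:Z * y'.
Proof.
elim: n x y => [|n IH] x y Nxy.
  by right; exists x, y; rewrite expn0 !mul1r.
have [qy|qy] := boolP (q %| `|y|)%N; last first.
  by left; apply: primitive_odd_norm qy Nxy; lia.
have qyz : (q %| y)%Z by [].
have qx : (q %| x)%Z.
  rewrite -dvdz_sqr.
  have -> : x * x = N x y - (x + e%:Z * y) * y by rewrite /qnorm; ring.
  apply: rpredB; last by rewrite dvdz_mull.
  by rewrite Nxy mulnS expnD dvdzE /= -mulnn -mulnA dvdn_mulr.
have [x1 x1E] := dvdzP qx; have [y1 y1E] := dvdzP qyz.
have N1 : N x1 y1 = (q ^ (2 * n))%N%:Z.
  have q0 := prime_gt0 q_pr.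
  have : (q * q)%N%:Z * N x1 y1 = (q * q)%N%:Z * (q ^ (2 * n))%N%:Z.
    rewrite -PoszM -[(q * q * _)%N]/(_) mulnn -expnD -[(2 + _)%N]mulnS -Nxy x1E y1E /qnorm.
    by rewrite -mulnn PoszM; ring.
  by apply: mulfI; rewrite -lt0n muln_gt0 q0.
have [odn|[x2 [y2 [ex ey]]]] := IH _ _ N1; first by left.
by right; exists x2, y2; rewrite x1E y1E ex ey expnS PoszM; split; ring.
Qed.

Section Split.
Variable r0 : int.
Hypothesis qr0 : (q %| N r0 1)%Z.
Hypothesis qp : q != p.

(** Hensel lifting.  The root is simple because
    (2r + 1)^2 = 4 N(r, 1) - p with q different from p. *)
Lemma root_lift n : exists r, ((q ^ n)%N %| N r 1)%Z.
Proof.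
suff [r h] : exists r, ((q ^ n.+1)%N %| N r 1)%Z.
  by exists r; apply: dvdz_trans h; rewrite dvdzE /= dvdn_exp2l.
elim: n => [|n [r h]]; first by exists r0; rewrite expn1.
have h' : (q %| N r 1)%Z.
  by apply: dvdz_trans h; rewrite dvdzE /= expnS dvdn_mulr.
have cop : coprimez (2 * r + 1) q.
  rewrite coprimezE /= coprime_sym prime_coprime //.
  apply/negP => h1; case/negP: qp; rewrite -dvdn_prime2 //.
  have : (q %| p%:Z)%Z.
    have -> : p%:Z = 4 * N r 1 - (2 * r + 1) * (2 * r + 1) by rewrite qnorm4; ring.
    by apply: rpredB; rewrite dvdz_mull.
  by [].
have [c cE] := dvdzP h.
have [[u v] /= uv] := coprimezP _ _ cop.
set Q := (q ^ n.+1)%N%:Z in cE *.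
exists (r - c * u * Q).
have -> : N (r - c * u * Q) 1 = (c * v + c * u * (c * u) * (q ^ n)%N%:Z) * (q%:Z * Q).
  have -> : N (r - c * u * Q) 1 =
      N r 1 - c * (u * (2 * r + 1)) * Q + c * u * (c * u) * Q * Q.
    by rewrite /qnorm; ring.
  have -> : u * (2 * r + 1) = 1 - v * q%:Z by rewrite -[LHS](addrK (v * q%:Z)) uv.
  have -> : c * u * (c * u) * Q * Q = c * u * (c * u) * (q ^ n)%N%:Z * q%:Z * Q.
    have QE : Q = (q ^ n)%N%:Z * q%:Z by rewrite /Q expnSr PoszM.
    by rewrite {1}QE; ring.
  by rewrite cE; ring.
by rewrite expnS PoszM dvdz_mull.
Qed.

(** Thue's pigeonhole argument: there are (q^n + 1)^2 points in a box of side
    q^n and only q^(2n) residues. *)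
Lemma thue (n : nat) (r : int) : exists x y : int,
  [/\ (x != 0) || (y != 0), (absz x <= q ^ n)%N, (absz y <= q ^ n)%N &
      ((q ^ n * q ^ n)%N %| x - r * y)%Z].
Proof.
set S := (q ^ n)%N; have S0 : (0 < S)%N by rewrite expn_gt0 prime_gt0.
have SS0 : (0 < S * S)%N by rewrite muln_gt0 S0.
have SSz : 0 < (S * S)%N%:Z by rewrite ltz_nat.
pose F (xy : 'I_S.+1 * 'I_S.+1) : int := xy.1%:Z - r * xy.2%:Z.
have F0 xy : 0 <= (F xy %% (S * S)%N)%Z by apply: modz_ge0; rewrite gt_eqF.
have Fb xy : (absz (F xy %% (S * S)%N)%Z < S * S)%N.
  by have := ltz_pmod (F xy) SSz; have := F0 xy; clear; lia.
pose G xy := Ordinal (Fb xy).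
have /injectivePn [[a b] [[a' b'] ne eG]] : ~~ injectiveb G.
  apply/negP => /injectiveP /leq_card.
  by rewrite card_prod !card_ord; clear; nia.
have mE : (F (a, b) = F (a', b') %[mod (S * S)%N])%Z.
  have := congr1 val eG => /=.
  by have := F0 (a, b); have := F0 (a', b'); clear; lia.
exists (a%:Z - a'%:Z), (b%:Z - b'%:Z); split.
- rewrite !subr_eq0 -negb_and; apply: contra ne => /andP[/eqP[e1] /eqP[e2]].
  by apply/eqP; congr pair; apply: val_inj.
- by have := ltn_ord a; have := ltn_ord a'; lia.
- by have := ltn_ord b; have := ltn_ord b'; lia.
have -> : a%:Z - a'%:Z - r * (b%:Z - b'%:Z) = F (a, b) - F (a', b').
  by rewrite /F /=; ring.
by rewrite -eqz_mod_dvd; apply/eqP.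
Qed.

(** The hypotheses say that x + y w lies in the ideal (d, r + w), whose norm
    is d. *)
Lemma dvdz_qnorm (d : int) r x y : (d %| N r 1)%Z -> (d %| x - r * y)%Z ->
  (d %| N x y)%Z.
Proof.
move=> h1 h2.
have -> : N x y = (x + (r + 1) * y) * (x - r * y) + y * y * N r 1.
  by rewrite /qnorm; ring.
by apply: rpredD; rewrite dvdz_mull.
Qed.

(** The ideal (q^(2n), r + w) has an element whose norm exceeds that of the
    ideal by a factor at most e + 2.  The exponent is even so that the box in
    Thue's argument has integral side. *)
Lemma short_vector (n : nat) (r : int) : ((q ^ (2 * n))%N %| N r 1)%Z ->
  exists x y c, [/\ N x y = (c * q ^ (2 * n))%N%:Z, (0 < c <= e + 2)%N &
     ((q ^ (2 * n))%N %| x - r * y)%Z].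
Proof.
move=> hr; have [x [y [xy0 xb yb h]]] := thue n r.
have eqn2 : (q ^ (2 * n) = q ^ n * q ^ n)%N by rewrite mul2n -addnn expnD.
rewrite eqn2 in hr *; have [c cE] := dvdzP (dvdz_qnorm hr h).
have S0 : (0 < q ^ n)%N by rewrite expn_gt0 prime_gt0.
have N0 := qnorm_gt0 xy0.
have Nb : N x y <= (e%:Z + 2) * (q ^ n * q ^ n)%N%:Z.
  move: xb yb; rewrite /qnorm; move: (q ^ n)%N => S xb yb.
  have h1 : x * x <= (S * S)%N%:Z by rewrite -absz_sqr lez_nat leq_mul.
  have h2 : y * y <= (S * S)%N%:Z by rewrite -absz_sqr lez_nat leq_mul.
  have h3 : x * y <= (S * S)%N%:Z.
    by apply: le_trans (ler_norm _) _; rewrite -abszE lez_nat abszM leq_mul.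
  have h4 : e%:Z * (y * y) <= e%:Z * (S * S)%N%:Z by rewrite ler_wpM2l.
  by clear -h1 h2 h3 h4; lia.
move: N0 Nb; rewrite cE; set SS := (q ^ n * q ^ n)%N%:Z.
have SS0 : 0 < SS by rewrite /SS ltz_nat muln_gt0 S0.
rewrite pmulr_lgt0 // ler_pM2r // => c0 cb.
exists x, y, (absz c); split; last exact: h.
  by rewrite cE [in RHS]PoszM abszE gtr0_norm.
by clear -c0 cb; lia.
Qed.

(** Two elements b and b' whose norms have the same cofactor c, and which are
    congruent mod c, have the product b' * conj(b) divisible by c, with
    quotient of norm q^(2(2n + s)).  If no norm is an odd power of q, that
    quotient is a power of q up to a unit, hence q^s divides b'.  But b' / q^s
    still lies in the ideal (q^(2n + s), r + w), so its norm is at least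
    q^(2n + s), which forces q^s <= c. *)
Lemma odd_norm_of_collision (n s c : nat) (r x y x' y' : int) :
  N x y = (c * q ^ (2 * n))%N%:Z -> N x' y' = (c * q ^ (2 * (n + s)))%N%:Z ->
  (0 < c < q ^ s)%N -> ((q ^ (2 * (n + s)))%N %| N r 1)%Z ->
  ((q ^ (2 * (n + s)))%N %| x' - r * y')%Z ->
  (c %| x' - x)%Z -> (c %| y' - y)%Z -> odd_norm.
Proof.
move=> Nxy Nxy' /andP[c0 cs] hr hx' cx cy.
have q0 k : (0 < q ^ k)%N by rewrite expn_gt0 prime_gt0.
have cN : (c %| N x y)%Z by rewrite Nxy dvdzE /= dvdn_mulr.
have [X XE] : exists X, x' * x + x' * y + e%:Z * (y' * y) = X * c%:Z.
  apply/dvdzP.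
  have -> : x' * x + x' * y + e%:Z * (y' * y) =
      N x y + (x + y) * (x' - x) + e%:Z * y * (y' - y) by rewrite /qnorm; ring.
  by apply: rpredD; [apply: rpredD => //|]; apply: dvdz_mull.
have [Y YE] : exists Y, y' * x - x' * y = Y * c%:Z.
  apply/dvdzP; have -> : y' * x - x' * y = x * (y' - y) - y * (x' - x) by ring.
  by apply: rpredB; apply: dvdz_mull.
have cz : c%:Z != 0 by rewrite -lt0n.
have NXY : N X Y = (q ^ (2 * (n + (n + s))))%N%:Z.
  apply: (@mulfI _ (c%:Z * c%:Z)); first by rewrite mulf_neq0.
  have -> : c%:Z * c%:Z * N X Y = N x y * N x' y'.
    transitivity (N (X * c%:Z) (Y * c%:Z)); first by rewrite /qnorm; ring.
    by rewrite -XE -YE /qnorm; ring.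
  have -> : (2 * (n + (n + s)) = 2 * n + 2 * (n + s))%N by rewrite mulnDr.
  by rewrite Nxy Nxy' expnD !PoszM; ring.
have [//|[X1 [Y1 [X1E Y1E]]]] := odd_norm_or_dvd NXY.
have E2 : (q ^ (2 * n))%N%:Z = (q ^ n)%N%:Z * (q ^ n)%N%:Z.
  by rewrite -PoszM -expnD addnn mul2n.
have E3 : (q ^ (n + (n + s)))%N%:Z = (q ^ n)%N%:Z * (q ^ n)%N%:Z * (q ^ s)%N%:Z.
  by rewrite -!PoszM -!expnD addnA.
have Qz k : (q ^ k)%N%:Z != 0 by rewrite -lt0n.
have x'E : x' = (X1 * x - e%:Z * Y1 * y) * (q ^ s)%N%:Z.
  apply: (@mulIf _ (c%:Z * (q ^ (2 * n))%N%:Z)); first by rewrite mulf_neq0.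
  have -> : x' * (c%:Z * (q ^ (2 * n))%N%:Z) = (X * x - e%:Z * Y * y) * c%:Z.
    transitivity (x' * N x y); first by rewrite Nxy PoszM.
    have -> : (X * x - e%:Z * Y * y) * c%:Z = x * (X * c%:Z) - e%:Z * y * (Y * c%:Z) by ring.
    by rewrite -XE -YE /qnorm; ring.
  by rewrite X1E Y1E E2 E3; ring.
have y'E : y' = (X1 * y + Y1 * x + Y1 * y) * (q ^ s)%N%:Z.
  apply: (@mulIf _ (c%:Z * (q ^ (2 * n))%N%:Z)); first by rewrite mulf_neq0.
  have -> : y' * (c%:Z * (q ^ (2 * n))%N%:Z) = (X * y + Y * x + Y * y) * c%:Z.
    transitivity (y' * N x y); first by rewrite Nxy PoszM.
    have -> : (X * y + Y * x + Y * y) * c%:Z = y * (X * c%:Z) + (x + y) * (Y * c%:Z) by ring.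
    by rewrite -XE -YE /qnorm; ring.
  by rewrite X1E Y1E E2 E3; ring.
move: x'E y'E; move: (X1 * x - _) (X1 * y + _ + _) => a b x'E y'E.
have E4 : (q ^ (2 * (n + s)))%N = (q ^ (2 * n + s) * q ^ s)%N.
  by rewrite -expnD; congr expn; lia.
have hab : ((q ^ (2 * n + s))%N %| a - r * b)%Z.
  rewrite -(dvdz_mul2r (Qz s)) -PoszM -E4.
  by have <- : x' - r * y' = (a - r * b) * (q ^ s)%N%:Z by rewrite x'E y'E; ring.
have hrs : ((q ^ (2 * n + s))%N %| N r 1)%Z.
  by apply: dvdz_trans hr; rewrite E4 PoszM dvdz_mulr.
have [d dE] := dvdzP (dvdz_qnorm hrs hab).
have : d * (q ^ s)%N%:Z = c%:Z.
  apply: (@mulIf _ (q ^ (2 * (n + s)))%N%:Z) => //.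
  transitivity (N x' y'); last by rewrite Nxy' PoszM.
  have -> : N x' y' = N a b * ((q ^ s)%N%:Z * (q ^ s)%N%:Z).
    by rewrite x'E y'E /qnorm; ring.
  by rewrite dE E4 PoszM; ring.
move=> dc; have d0 : 0 < d.
  have : 0 < d * (q ^ s)%N%:Z by rewrite dc ltz_nat.
  by rewrite pmulr_lgt0 // ltz_nat.
suff : c%:Z < c%:Z by rewrite ltxx.
rewrite -{2}dc; apply: lt_le_trans (_ : (q ^ s)%N%:Z <= _); first by rewrite ltz_nat.
by rewrite ler_peMl // -gtz0_ge1.
Qed.

(** The pigeonhole principle on the cofactor c and the coordinates mod c plays
    the role of the finiteness of the class group.  Only exponents that are
    multiples of B = e + 2 are used, so that two colliding ones differ by an s
    with q^s > c. *)
Lemma odd_norm_exists : odd_norm.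
Proof.
pose B := (e + 2)%N.
pose M := #|{: 'I_B.+1 * 'I_B.+1 * 'I_B.+1}|.
have [r hr] := root_lift (2 * (B * M)).
have hr' k : (k <= M)%N -> ((q ^ (2 * (B * k)))%N %| N r 1)%Z.
  move=> kM; apply: dvdz_trans hr; rewrite dvdzE /= dvdn_exp2l //.
  by rewrite leq_mul2l leq_mul2l kM !orbT.
have v (k : 'I_M.+1) : exists t : int * int * nat,
    [/\ N t.1.1 t.1.2 = (t.2 * q ^ (2 * (B * k)))%N%:Z, (0 < t.2 <= B)%N &
     ((q ^ (2 * (B * k)))%N %| t.1.1 - r * t.1.2)%Z].
  have [x [y [c h]]] := short_vector (hr' k (ltn_ord k)).
  by exists (x, y, c).
have [V hV] := choice v.
pose res (z : int) (c : nat) : 'I_B.+1 := inord (absz (z %% c)%Z).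
pose G k := (inord (V k).2 : 'I_B.+1, res (V k).1.1 (V k).2, res (V k).1.2 (V k).2).
have [i [j [ij eG]]] : exists i j : 'I_M.+1, (i < j)%N /\ G i = G j.
  have /injectivePn [a [b ne eab]] : ~~ injectiveb G.
    by apply/negP => /injectiveP /leq_card; rewrite card_ord ltnn.
  case: (ltngtP a b) => h; [by exists a, b|by exists b, a|].
  by case/eqP: ne; apply: val_inj.
have [Nj cj dj] := hV j; have [Ni ci di] := hV i; move: eG; rewrite /G => -[].
have le_iM : (B * i <= B * M)%N by rewrite leq_mul2l -ltnS ltn_ord orbT.
have sij : (B <= B * j - B * i)%N by rewrite -mulnBr leq_pmulr // subn_gt0.
move=> /(congr1 val) /=; case/andP: ci => ci0 ciB; case/andP: cj => cj0 cjB.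
rewrite !inordK // => cE /(congr1 val) /=; rewrite /res cE in ci0 ciB di Ni *.
have rb (z : int) : (absz (z %% (V j).2)%Z < B.+1)%N.
  have c0z : 0 < (V j).2%:Z by rewrite ltz_nat.
  have := ltz_pmod z c0z; have := modz_ge0 z (lt0r_neq0 c0z).
  by clear -cjB; lia.
have rE (z z' : int) : absz (z %% (V j).2)%Z = absz (z' %% (V j).2)%Z -> ((V j).2 %| z' - z)%Z.
  rewrite -eqz_mod_dvd => h; apply/eqP.
  have c0z : (V j).2%:Z != 0 by rewrite -lt0n.
  by have := modz_ge0 z c0z; have := modz_ge0 z' c0z; clear -h; lia.
rewrite !inordK // => /rE xE /(congr1 val) /=; rewrite !inordK // => /rE yE.
have nE : (B * j = B * i + (B * j - B * i))%N.
  by rewrite subnKC // leq_mul2l ltnW ?orbT.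
rewrite nE in Nj dj.
apply: (odd_norm_of_collision (r := r) Ni Nj _ _ dj xE yE).
  rewrite cj0 (leq_ltn_trans cjB) // (leq_ltn_trans sij) // ltn_expl // prime_gt1 //.
by rewrite -nE; apply: hr'; rewrite -ltnS ltn_ord.
Qed.
End Split.
End Prime.
End Genus.

(** * Lengths of modules inside a field *)

Section Chains.
Variables (K : fieldType) (R : subringClosed K).

(** The R-submodules of K, as plain sets: the local rings and their ideals all
    lie in K, where they can be scaled and conjugated freely. *)
Definition is_submod (I : set K) : Prop :=
  I 0 /\ forall r x y, r \in R -> I x -> I y -> I (r * x + y).

Definition covers (N M : set K) : Prop :=
  [/\ N `<=` M, ~ M `<=` N &
      forall L, is_submod L -> N `<=` L -> L `<=` M -> L `<=` N \/ M `<=` L].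

Inductive chain (N : set K) : set K -> nat -> Prop :=
| chain0 : is_submod N -> chain N N 0
| chainS P M n : chain N P n -> is_submod M -> covers P M -> chain N M n.+1.

Lemma submodD I x y : is_submod I -> I x -> I y -> I (x + y).
Proof. by case=> _ h Ix Iy; rewrite -[x]mul1r; apply: h; rewrite ?rpred1. Qed.

Lemma submodM I r x : is_submod I -> r \in R -> I x -> I (r * x).
Proof. by case=> I0 h rR Ix; rewrite -[_ * _]addr0; apply: h. Qed.

Lemma submodN I x : is_submod I -> I x -> I (- x).
Proof. by move=> hI Ix; rewrite -mulN1r; apply: submodM; rewrite ?rpredN1. Qed.

Lemma submodB I x y : is_submod I -> I x -> I y -> I (x - y).
Proof. by move=> hI Ix Iy; apply: submodD => //; apply: submodN. Qed.

Lemma submodI I J : is_submod I -> is_submod J -> is_submod (I `&` J).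
Proof.
move=> [I0 hI] [J0 hJ]; split=> // r x y rR [Ix Jx] [Iy Jy].
by split; [apply: hI | apply: hJ].
Qed.

Definition sumset (I J : set K) : set K :=
  [set z | exists x y, [/\ I x, J y & z = x + y]].

Lemma sumsetl I J : is_submod J -> I `<=` sumset I J.
Proof. by move=> [J0 _] x Ix; exists x, 0; rewrite addr0. Qed.

Lemma sumsetr I J : is_submod I -> J `<=` sumset I J.
Proof. by move=> [I0 _] x Jx; exists 0, x; rewrite add0r. Qed.

Lemma sumset_sub I J L :
  is_submod L -> I `<=` L -> J `<=` L -> sumset I J `<=` L.
Proof.
by move=> hL IL JL _ [x [y [Ix Jy ->]]]; apply: submodD; [|apply: IL|apply: JL].
Qed.

Lemma sumset_submod I J : is_submod I -> is_submod J -> is_submod (sumset I J).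
Proof.
move=> [I0 hI] [J0 hJ]; split; first by exists 0, 0; rewrite addr0.
move=> r _ _ rR [x [y [Ix Jy ->]]] [x' [y' [Ix' Jy' ->]]].
exists (r * x + x'), (r * y + y'); split; [exact: hI|exact: hJ|].
by rewrite mulrDr addrACA.
Qed.

Lemma chain_submod N M n : chain N M n -> is_submod N /\ is_submod M.
Proof. by elim=> // {M n} P M n _ []. Qed.

Lemma chain_sub N M n : chain N M n -> N `<=` M.
Proof.
elim=> {M n} [_|P M n _ NP _ [PM _ _]]; first exact: subset_refl.
exact: subset_trans PM.
Qed.

(** By the second isomorphism theorem Q / (P :&: Q) is M / P, since P + Q = M. *)
Lemma covers_capr P Q M :
  is_submod P -> is_submod Q -> is_submod M ->
  covers P M -> covers Q M -> ~ Q `<=` P -> covers (P `&` Q) Q.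
Proof.
move=> hP hQ hM [PM nMP maxP] [QM nMQ maxQ] nQP; split.
- by move=> x [].
- by move=> h; apply: nQP => x /h [].
move=> L hL PQL LQ.
have hPL := sumset_submod hP hL.
have PLM : sumset P L `<=` M.
  by apply: sumset_sub => //; apply: subset_trans QM.
have [h|h] := maxP _ hPL (sumsetl hL) PLM.
  by left=> x Lx; split; [apply/h/sumsetr|apply: LQ].
right=> x Qx; have [a [b [Pa Lb xE]]] := h _ (QM _ Qx).
rewrite xE; apply: submodD => //; apply: PQL; split=> //.
have -> : a = x - b by rewrite xE addrK.
by apply: submodB => //; apply: LQ.
Qed.

(** The induction behind Jordan-Hoelder.  If the last step of the given chain
    starts at some P' other than Q, then P' :&: Q is maximal in both; the
    induction hypothesis shortens the chain to P' down to P' :&: Q, and one more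
    step leads up to Q. *)
Lemma chain_drop_top N M n P :
  chain N M n -> is_submod P -> covers P M -> N `<=` P ->
  exists2 n', n = n'.+1 & chain N P n'.
Proof.
move=> c; elim: c P => {M n} [hN|P M n c IH hM PM] Q hQ QM NQ.
  by case: QM.
exists n => //.
have hP := (chain_submod c).2.
have [QP|nQP] := pselect (Q `<=` P).
  suff -> : Q = P by [].
  rewrite eqEsubset; split=> //.
  by have [sPM nMP _] := PM; have [_ _ /(_ P hP QP sPM) []] := QM.
have cQ : covers (P `&` Q) Q by apply: (@covers_capr P Q M).
have cP : covers (P `&` Q) P.
  rewrite setIC; apply: (@covers_capr Q P M) => // PQ.
  have [_ _ /(_ Q hQ PQ) maxP] := PM; have [sQM nMQ _] := QM.
  by case: (maxP sQM).
have NPQ : N `<=` P `&` Q.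
  by move=> x Nx; split; [apply: (chain_sub c)|apply: NQ].
have [n' -> c'] := IH _ (submodI hP hQ) cP NPQ.
exact: chainS cQ.
Qed.

Lemma chain_uniq N M n m : chain N M n -> chain N M m -> n = m.
Proof.
move=> c c'; elim: c' n c => {M m} [hN|P M m c' IH hM PM] n c.
  have [M eM] : exists M, M = N by exists N.
  rewrite -{2}eM in c; case: c eM => // {M n} P M n c _ [_ nMP _] eM.
  by case: nMP; rewrite eM; apply: chain_sub c.
have [n' -> cP] := chain_drop_top c (chain_submod c').2 PM (chain_sub c').
by rewrite (IH _ cP).
Qed.

Lemma chain_cat N P M m n : chain N P m -> chain P M n -> chain N M (m + n).
Proof.
move=> c; elim=> {M n} [_|Q M n _ IH hM QM]; first by rewrite addn0.
by rewrite addnS; apply: chainS QM.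
Qed.

(** Adding J to every term of a chain, each step stays maximal or collapses. *)
Lemma chain_sum N M n J : is_submod J ->
  chain N M n -> exists k, chain (sumset N J) (sumset M J) k.
Proof.
move=> hJ; elim=> {M n} [hN|P M n c [k IH] hM [PM nMP maxP]].
  by exists 0%N; constructor; apply: sumset_submod.
have hP := (chain_submod c).2.
have sPM : sumset P J `<=` sumset M J.
  by move=> _ [x [y [Px Jy ->]]]; exists x, y; split=> //; apply: PM.
have [MPJ|nMPJ] := pselect (sumset M J `<=` sumset P J).
  by exists k; suff -> : sumset M J = sumset P J by []; rewrite eqEsubset.
exists k.+1; apply: chainS IH _ _; first exact: sumset_submod.
split=> // L hL PJL LMJ.
have PL : P `<=` L by apply: subset_trans PJL; apply: sumsetl.
have JL : J `<=` L by apply: subset_trans PJL; apply: sumsetr.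
have PLM : P `<=` L `&` M by move=> x Px; split; [apply: PL|apply: PM].
have [h|h] := maxP _ (submodI hL hM) PLM (@subIsetr _ _ _).
  left=> x Lx; have [a [b [Ma Jb xE]]] := LMJ _ Lx.
  exists a, b; split=> //; apply: h; split=> //.
  have -> : a = x - b by rewrite xE addrK.
  by apply: submodB => //; apply: JL.
by right; apply: sumset_sub => // x /h [].
Qed.

(** Finite length of M / N passes to the quotient M / J. *)
Lemma chain_upper N M n J : is_submod J -> N `<=` J -> J `<=` M ->
  chain N M n -> exists k, chain J M k.
Proof.
move=> hJ NJ JM c; have [hN hM] := chain_submod c.
have [k] := chain_sum hJ c.
have -> : sumset N J = J.
  by rewrite eqEsubset; split; [apply: sumset_sub|apply: sumsetr].
have -> : sumset M J = M.
  by rewrite eqEsubset; split; [apply: sumset_sub|apply: sumsetl].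
by exists k.
Qed.

(** Semilinear bijections preserve lengths.  This serves for scaling, with s
    the identity, and for a field automorphism preserving R. *)
Lemma chain_preim (g h : K -> K) (s : K -> K) N M n :
  cancel g h -> cancel h g -> g 0 = 0 -> {morph g : x y / x + y} ->
  (forall r x, g (r * x) = s r * g x) ->
  (forall r, (r \in R) -> s r \in R) ->
  (forall r, (r \in R) -> exists2 r', r' \in R & s r' = r) ->
  chain N M n -> chain (g @^-1` N) (g @^-1` M) n.
Proof.
move=> gK hK g0 gD gM sR Rs.
have h0 : h 0 = 0 by rewrite -g0 gK.
have sub I : is_submod I -> is_submod (g @^-1` I).
  move=> [I0 hI]; split; first by rewrite /= g0.
  by move=> r x y rR Ix Iy /=; rewrite gD gM; apply: hI => //; apply: sR.
have sub' I : is_submod I -> is_submod (h @^-1` I).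
  move=> [I0 hI]; split; first by rewrite /= h0.
  move=> r x y rR Ix Iy /=; have [r' r'R <-] := Rs _ rR.
  suff -> : h (s r' * x + y) = r' * h x + h y by apply: hI.
  by rewrite -[LHS]gK; apply: (can_inj gK); rewrite gK gD gM !hK.
elim=> {M n} [hN|P M n c IH hM [PM nMP maxP]]; first by constructor; apply: sub.
apply: chainS IH (sub _ hM) _; split.
- by move=> x; apply: PM.
- by move=> h'; apply: nMP => x Mx; rewrite -[x]hK; apply: h'; rewrite /= hK.
move=> L hL PL LM.
have [||H|H] := maxP _ (sub' _ hL).
- by move=> x Px; apply: PL; rewrite /= hK.
- by move=> x /LM; rewrite /= hK.
- by left=> x Lx; apply: H; rewrite /= gK.
- by right=> x /H; rewrite /= gK.
Qed.

Definition principal (a : K) : set K := [set x | exists2 r, r \in R & x = r * a].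

Lemma principal_submod a : is_submod (principal a).
Proof.
split; first by exists 0; rewrite ?rpred0 ?mul0r.
move=> r _ _ rR [x xR ->] [y yR ->]; exists (r * x + y); last by ring.
by rewrite rpredD // rpredM.
Qed.

Lemma principal_sub a I : is_submod I -> I a -> principal a `<=` I.
Proof. by move=> hI Ia _ [r rR ->]; apply: submodM. Qed.

Lemma mem_principal a : principal a a.
Proof. by exists 1; rewrite ?rpred1 ?mul1r. Qed.

(** For a in R this says that R / a R has length n. *)
Definition has_length (a : K) (n : nat) : Prop := chain (principal a) (principal 1) n.

Lemma principal1E x : principal 1 x <-> x \in R.
Proof. by split=> [[r rR ->]|xR]; [rewrite mulr1|exists x; rewrite ?mulr1]. Qed.

Lemma has_length_uniq a m n : has_length a m -> has_length a n -> m = n.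
Proof. exact: chain_uniq. Qed.

(** Multiplication by a identifies R / b R with a R / a b R. *)
Lemma has_lengthM a b m n : a != 0 ->
  has_length a m -> has_length b n -> has_length (a * b) (m + n).
Proof.
move=> a0 ha hb; rewrite addnC; apply: chain_cat ha.
have key x : principal a x = principal 1 (a^-1 * x).
  apply/propext; split=> [[r rR ->]|[r rR e]]; exists r => //.
    by rewrite mulrCA mulVf.
  by rewrite -[r]mulr1 -e mulrC mulVKf.
have key' x : principal (a * b) x = principal b (a^-1 * x).
  apply/propext; split=> [[r rR ->]|[r rR e]]; exists r => //.
    by field.
  by rewrite mulrCA -e mulVKf.
have -> : principal (a * b) = (fun x => a^-1 * x) @^-1` (principal b).
  by apply/seteqP; split=> x /=; rewrite key'.
have -> : principal a = (fun x => a^-1 * x) @^-1` (principal 1).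
  by apply/seteqP; split=> x /=; rewrite key.
apply: (@chain_preim _ (fun x => a * x) id) hb => //.
- by move=> x; rewrite mulVKf.
- by move=> x; rewrite mulKf.
- by rewrite mulr0.
- by move=> x y; rewrite mulrDr.
- by move=> r x; rewrite mulrCA.
- by move=> r rR; exists r.
Qed.

Lemma has_length_unit a : a \in R -> a^-1 \in R -> a != 0 -> has_length a 0.
Proof.
move=> aR aVR a0; rewrite /has_length.
suff -> : principal 1 = principal a by constructor; apply: principal_submod.
rewrite eqEsubset; split; apply: principal_sub; try exact: principal_submod.
  by exists a^-1; rewrite ?mulVf.
by exists a; rewrite ?mulr1.
Qed.

Lemma has_length_conj (s : K -> K) a n :
  involutive s -> {morph s : x y / x + y} -> {morph s : x y / x * y} ->
  (forall r, r \in R -> s r \in R) ->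
  has_length a n -> has_length (s a) n.
Proof.
move=> sK sD sM sR.
have s0 : s 0 = 0 by apply: (addIr (s 0)); rewrite -sD !addr0 add0r.
have key b : principal (s b) = s @^-1` principal b.
  apply/seteqP; split=> x /=; case=> r rR.
    by move=> ->; exists (s r); rewrite ?sM ?sK //; apply: sR.
  by move=> e; exists (s r); [apply: sR|rewrite -sM -e sK].
have s1 : s 1 = 1 by rewrite -[LHS]mulr1 -{2}[1]sK -sM mul1r sK.
rewrite /has_length key -{2}s1 key; apply: (@chain_preim s s s) => //.
by move=> r rR; exists (s r); [apply: sR|].
Qed.

(** Finite length of R / a R is often easiest to see on a multiple of a. *)
Lemma has_length_dvd a b n : a != 0 -> b \in R -> a \in R ->
  has_length (a * b) n -> exists k, has_length a k.
Proof.
move=> a0 bR aR c; apply: chain_upper c.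
- exact: principal_submod.
- by apply: principal_sub; [apply: principal_submod|exists b; rewrite // mulrC].
by move=> x [r rR ->]; apply/principal1E; rewrite rpredM.
Qed.

Variable m : set K.
Hypothesis mR : m `<=` [set x | x \in R].
Hypothesis m_submod : is_submod m.
Hypothesis m1 : ~ m 1.
Hypothesis unitR : forall x, x \in R -> ~ m x -> x^-1 \in R.

Lemma local_eqR I x : is_submod I -> I x -> x \in R -> ~ m x -> principal 1 `<=` I.
Proof.
move=> hI Ix xR mx; apply: principal_sub => //.
have x0 : x != 0 by apply: contra_notN mx => /eqP ->; case: m_submod.
by rewrite -(mulVf x0); apply: submodM => //; apply: unitR.
Qed.

Lemma maximal_covers : covers m (principal 1).
Proof.
split.
- by move=> x /mR /= xR; apply/principal1E.
- by move=> h; apply/m1/h/mem_principal.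
move=> L hL mL LR; have [Lm|] := pselect (L `<=` m); first by left.
move=> /existsNP [x /not_implyP [Lx nmx]]; right; apply: (local_eqR hL Lx) => //.
by apply/principal1E/LR.
Qed.

Lemma has_length_uniformizer a : m = principal a -> has_length a 1.
Proof.
move=> e; rewrite /has_length -e; apply: chainS maximal_covers.
  by constructor.
exact: principal_submod.
Qed.

(** If the maximal ideal m is generated by q and t, with t^2 in q R, then m
    annihilates t modulo q R, so that m / q R is the residue field and R / q R
    resembles a ring of dual numbers. *)
Lemma has_length_dual (q t : K) : q \in R -> m q ->
  m = sumset (principal q) (principal t) -> ~ principal q t ->
  principal q (t * t) -> has_length q 2.
Proof.
move=> qR mq mE nqt qtt; apply: chainS maximal_covers; last exact: principal_submod.
have hq := principal_submod q.
apply: chainS (chain0 hq) m_submod _; split.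
- exact: principal_sub.
- by move=> h; apply/nqt/h; rewrite mE; apply: sumsetr => //; apply: mem_principal.
move=> L hL qL Lm; have [LT|nLT] := pselect (L t).
  right; rewrite mE; apply: sumset_sub => //; exact: principal_sub.
left=> x Lx; have := Lm _ Lx; rewrite {1}mE => -[_ [_ [[u uR ->] [v vR ->] xE]]].
have Lvt : L (v * t).
  have -> : v * t = x - u * q by rewrite xE addrC addKr.
  by apply: submodB => //; apply/qL; exists u.
have mv : m v.
  have [//|nmv] := pselect (m v); case: nLT.
  have v0 : v != 0 by apply: contra_notN nmv => /eqP ->; case: m_submod.
  by rewrite -(mulKf v0 t); apply: submodM => //; apply: unitR.
rewrite xE; apply: submodD => //; first by exists u.
move: mv; rewrite mE => -[_ [_ [[c cR ->] [d dR ->] ->]]].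
have tR : t \in R.
  by apply: mR; rewrite mE; apply: sumsetr => //; apply: mem_principal.
have -> : (c * q + d * t) * t = (c * t) * q + d * (t * t) by ring.
by apply: submodD => //; [exists (c * t); rewrite ?rpredM|apply: submodM].
Qed.

End Chains.

(** * Composition series of a quotient by a principal ideal *)

Section Bridge.
Variables (K : fieldType) (T : subringClosed K).
Local Notation R := (subring_of T).
Variable a : R.
Local Notation Q := (quotmod (principal_submodule a)).
Local Notation pi := (@quotmod_pi _ _ (principal_submodule a)).

Lemma quotmod_piZ (r : R) (x : R^o) : pi (r *: x) = r *: pi x.
Proof. exact: (esym (quotmod_scale_pi (principal_submodule a) r x)). Qed.

Lemma quotmod_pi0 : pi 0 = 0.
Proof. by apply: (addIr (pi 0)); rewrite -quotmod_piD !add0r. Qed.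

Lemma quotmod_pi_eq0 (x : R) : pi x = 0 <-> principal T (val a) (val x).
Proof.
rewrite -quotmod_pi0; split.
  move/eqP; rewrite -Quotient.idealrBE subr0 => /asboolP [r ->].
  by exists (val r) => //; apply: valP.
case=> r rT e; apply/eqP; rewrite -Quotient.idealrBE subr0; apply/asboolP.
by exists (exist _ r rT); apply: val_inj.
Qed.

Definition lift_pred (F : {pred Q}) : set K :=
  [set x | exists2 r : R, x = val r & pi r \in F].

Definition quot_pred (I : set K) : {pred Q} :=
  fun z => `[< I (val (repr z : R)) >].

(** Since I contains a R, membership of the chosen representative is membership
    of every representative. *)
Lemma quot_predE I (x : R) : is_submod T I -> principal T (val a) `<=` I ->
  reflect (I (val x)) (pi x \in quot_pred I).
Proof.
move=> hI aI.
have e : principal T (val a) (val x - val (repr (pi x) : R)).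
  rewrite -[_ - _]/(val (x - repr (pi x) : R)); apply/quotmod_pi_eq0.
  have e : pi (x - repr (pi x) : R) + pi (repr (pi x)) = 0 + pi x.
    by rewrite -quotmod_piD subrK add0r.
  by apply: (addIr (pi x)); rewrite -e quotmod_piK.
apply: (iffP (asboolP _)) => h.
  by rewrite -(subrK (val (repr (pi x) : R)) (val x)); apply: (submodD hI) => //; apply: aI.
rewrite -[X in I X](subKr (val x)); apply: (submodB hI) => //; exact: aI.
Qed.

Lemma lift_predE F (x : R) : lift_pred F (val x) <-> pi x \in F.
Proof. by split=> [[r /val_inj ->]|h] //; exists x. Qed.

Lemma lift_submod F : submod_closed F -> is_submod T (lift_pred F).
Proof.
move=> [F0 hF]; split.
  by exists 0 => //; rewrite quotmod_pi0.
move=> r _ _ rT [x -> xF] [y -> yF].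
exists ((exist _ r rT : R) * x + y) => //.
by rewrite quotmod_piD quotmod_piZ; apply: hF.
Qed.

Lemma lift_principal F : submod_closed F -> principal T (val a) `<=` lift_pred F.
Proof.
move=> [F0 hF] _ [r rT ->]; exists ((exist _ r rT : R) * a) => //.
suff -> : pi (((exist _ r rT : R) * a)) = 0 by [].
by apply/quotmod_pi_eq0; exists r.
Qed.

Lemma quot_submod I : is_submod T I -> principal T (val a) `<=` I ->
  submod_closed (quot_pred I).
Proof.
move=> hI aI; split.
  by rewrite -quotmod_pi0; apply/quot_predE => //; case: hI.
move=> r x y; rewrite -[x]quotmod_piK -[y]quotmod_piK .
move=> /(quot_predE _ hI aI) hx /(quot_predE _ hI aI) hy.
rewrite -quotmod_piZ -quotmod_piD; apply/quot_predE => //.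
by case: hI => _ hI; apply: hI; [apply: valP|apply: hx|apply: hy].
Qed.

Lemma lift_covers F G : submod_closed F -> submod_closed G ->
  maximal_in F G -> covers T (lift_pred F) (lift_pred G).
Proof.
move=> hF hG [FG nGF maxF]; split.
- by move=> _ [r -> rF]; exists r => //; apply: FG.
- move=> h; apply: nGF => z; rewrite -[z]quotmod_piK => zG.
  by apply/lift_predE/h/lift_predE.
move=> L hL FL LG.
have aL : principal T (val a) `<=` L.
  by apply: subset_trans FL; apply: lift_principal.
have [||e|e] := maxF _ (quot_submod hL aL).
- by move=> z; rewrite -[z]quotmod_piK => zF; apply/quot_predE => //; apply/FL/lift_predE.
- by move=> z; rewrite -[z]quotmod_piK => /(quot_predE _ hL aL) h; apply/lift_predE/LG.
- left=> x Lx; have [r xE _] := LG _ Lx; rewrite xE; apply/lift_predE; rewrite -e.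
  by apply/quot_predE => //; rewrite -xE.
- by right=> _ [r -> rG]; apply/quot_predE => //; rewrite e.
Qed.

Lemma quot_covers I J : is_submod T I -> is_submod T J ->
  principal T (val a) `<=` I -> J `<=` principal T 1 -> 
  covers T I J -> maximal_in (quot_pred I) (quot_pred J).
Proof.
move=> hI hJ aI JR [IJ nJI maxI].
have aJ : principal T (val a) `<=` J by apply: subset_trans IJ.
split.
- by move=> z; rewrite -[z]quotmod_piK => /(quot_predE _ hI aI) h; apply/quot_predE => //; apply/IJ.
- move=> h; apply: nJI => x Jx; have /principal1E xT := JR _ Jx.
  by apply: (elimT (@quot_predE I (exist _ x xT : R) hI aI)); apply/h/quot_predE.
move=> L hL IL LJ.
have [||e|e] := maxI _ (lift_submod hL).
- move=> x Ix; have /principal1E xT := JR _ (IJ _ Ix).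
  by exists (exist _ x xT : R) => //; apply/IL/quot_predE.
- by move=> _ [r -> rL]; apply/quot_predE => //; apply: LJ.
- left=> z; apply/idP/idP; last exact: IL.
  by rewrite -[z]quotmod_piK => zL; apply/quot_predE => //; apply/e/lift_predE.
- right=> z; apply/idP/idP; first exact: LJ.
  by rewrite -[z]quotmod_piK => /(quot_predE _ hJ aJ) h; apply/lift_predE/e.
Qed.

Lemma chain_composition M n : M `<=` principal T 1 -> chain T (principal T (val a)) M n ->
  exists F : nat -> {pred Q}, [/\ forall i, (i <= n)%N -> submod_closed (F i),
      F 0%N =i pred1 0, F n =i quot_pred M &
      forall i, (i < n)%N -> maximal_in (F i) (F i.+1)].
Proof.
move=> MR c; elim: c MR => {M n} [hN|P M n c IH hM PM] MR.
  exists (fun=> quot_pred (principal T (val a))); split=> //.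
  - by move=> i _; apply: quot_submod.
  move=> z; rewrite -[z]quotmod_piK; apply/idP/eqP => h.
    by apply/quotmod_pi_eq0/(quot_predE _ hN).
  by apply/(quot_predE _ hN) => //; apply/quotmod_pi_eq0.
have hP := (chain_submod c).2.
have aP := chain_sub c.
have sPM : P `<=` M by case: PM.
have [F [F1 F2 F3 F4]] := IH (subset_trans sPM MR).
pose G i := if (i <= n)%N then F i else quot_pred M.
exists G; split.
- move=> i _; rewrite /G; case: ifP => // [/F1 //|_].
  by apply: quot_submod => //; apply: subset_trans sPM.
- exact: F2.
- by rewrite /G ltnn.
move=> i; rewrite ltnS /G => le_in; rewrite le_in; case: ltnP => [|le_ni]; first exact: F4.
have -> : i = n by apply/eqP; rewrite eqn_leq le_in.
have [h1 h2 h3] := quot_covers hP hM aP MR PM.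
split.
- by move=> z; rewrite F3; apply: h1.
- by move=> h; apply: h2 => z /h; rewrite F3.
move=> L hL FL LM; have [||e|e] := h3 L hL; [|by []| |].
- by move=> z; rewrite -F3; apply: FL.
- by left=> z; rewrite e F3.
- by right.
Qed.

Lemma composition_chain (F : nat -> {pred Q}) n : @composition_series R Q n F ->
  chain T (principal T (val a)) (principal T 1) n.
Proof.
move=> [F1 F2 F3 F4].
have -> : principal T (val a) = lift_pred (F 0%N).
  apply/seteqP; split; first by apply/lift_principal/F1.
  by move=> _ [r -> ]; rewrite F2 => /eqP /quotmod_pi_eq0.
have -> : principal T 1 = lift_pred (F n).
  apply/seteqP; split=> [x /principal1E xT|_ [r -> _]].
    by exists (exist _ x xT : R) => //; rewrite F3.
  by apply/principal1E/valP.
have: (n <= n)%N by []. 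
elim: {-2}n => [|i IH] hi; first by constructor; apply/lift_submod/F1.
apply: chainS (IH (ltnW hi)) _ _; first exact/lift_submod/F1.
by apply: lift_covers; [apply/F1/ltnW|apply: F1|apply: F4].
Qed.

(** Submodules of R / a R correspond to those between a R and R; uniqueness of
    the length of a chain makes every choice of a composition series agree. *)
Lemma mod_lengthE n : has_length T (val a) n -> mod_length Q = n.
Proof.
move=> c; rewrite /mod_length; case: xgetP => [m -> [F hF]|].
  exact: chain_uniq (composition_chain hF) c.
have [F [F1 F2 F3 F4]] := chain_composition (@subset_refl _ _) c.
move=> /(_ n) []; exists F; split=> // z; rewrite F3 -[z]quotmod_piK; apply/quot_predE.
- exact: (principal_submod T 1).
- exact: chain_sub c.
- exact/principal1E/valP.
Qed.

End Bridge.

(** * Maximal ideals, localizations and divisors of an order *)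

Section MaximalIdealsInField.
Variables (K : fieldType) (S : subringClosed K).
Implicit Types P : maximal_ideal (subring_of S).

(** Maximal ideals as subsets of the field, to be compared there with the
    ideals of the localization. *)
Definition ideal_set P : set K := [set z | exists2 a : subring_of S, a \in P & z = val a].

Lemma ideal_setE P (a : subring_of S) : ideal_set P (val a) <-> a \in P.
Proof. by split=> [[b bP /val_inj ->]|aP] //; exists a. Qed.

Lemma ideal_set_sub P : ideal_set P `<=` [set z | z \in S].
Proof. by move=> _ [a _ ->]; apply: valP. Qed.

Lemma ideal_set_submod P : is_submod S (ideal_set P).
Proof.
have [p0 p1 pD] := maxideal_ideal P; split; first by exists 0.
move=> r _ _ rS [a aP ->] [b bP ->].
by exists ((exist _ r rS : subring_of S) * a + b) => //; apply: pD.
Qed.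

Lemma ideal_set1 P : ~ ideal_set P 1.
Proof.
have [p0 p1 pD] := maxideal_ideal P => -[a aP e]; case/negP: p1.
by have -> : 1 = a by apply: val_inj.
Qed.

Lemma ideal_set_prime P x y : x \in S -> y \in S ->
  ideal_set P (x * y) -> ideal_set P x \/ ideal_set P y.
Proof.
move=> xS yS; pose a : subring_of S := exist _ x xS; pose b : subring_of S := exist _ y yS.
rewrite -[x]/(val a) -[y]/(val b) -[_ * _]/(val (a * b)) !ideal_setE => abP.
have [|aP] := boolP (a \in P); [by left|right].
by apply: contraLR abP; apply: maximal_ideal_prime.
Qed.

(** Otherwise x and P would generate a proper ideal larger than P. *)
Lemma ideal_set_comaximal P x : x \in S -> ~ ideal_set P x ->
  exists r u, [/\ r \in S, ideal_set P u & r * x + u = 1].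
Proof.
move=> xS nPx; apply: contrapT => no.
pose I : {pred subring_of S} := fun z =>
  `[< exists r u, [/\ r \in S, ideal_set P u & val z = r * x + u] >].
have Pm := ideal_set_submod P.
have Iid : idealr_closed I.
  split.
  - by apply/asboolP; exists 0, 0; rewrite rpred0 mul0r addr0; split=> //; case: Pm.
  - apply/negP => /asboolP [r [u [rS Pu e]]]; by apply: no; exists r, u; split.
  move=> a b c /asboolP [r [u [rS Pu be]]] /asboolP [r' [u' [rS' Pu' ce]]].
  apply/asboolP; exists (val a * r + r'), (val a * u + u'); split.
  - by rewrite rpredD // rpredM //; apply: valP.
  - by case: Pm => _; apply=> //; apply: valP.
  by rewrite /= be ce; ring.
apply: nPx; rewrite -[x]/(val (exist _ x xS : subring_of S)); apply/ideal_setE.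
apply: (maxideal_max Iid) => [z zP|]; apply/asboolP.
  by exists 0, (val z); rewrite rpred0 mul0r add0r; split=> //; apply/ideal_setE.
by exists 1, 0; rewrite rpred1 mul1r addr0; split=> //; case: Pm.
Qed.

Lemma ideal_set_inj P Q : ideal_set P `<=` ideal_set Q -> P = Q.
Proof.
move=> PQ.
have sPQ : {subset P <= Q} by move=> a aP; apply/ideal_setE/PQ/ideal_setE.
have sQP : {subset Q <= P} := maxideal_max (maxideal_ideal Q) sPQ.
case: P Q {PQ} sPQ sQP => [P hP mP] [Q hQ mQ] sPQ sQP.
have PQ : P = Q.
  by apply/funext => a; apply/idP/idP; [apply: sPQ|apply: sQP].
by subst Q; congr MaximalIdeal; apply: Prop_irrelevance.
Qed.

Section Local.
Variable P : maximal_ideal (subring_of S).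
Local Notation R := (loc_pred P).

Lemma locP x : reflect (exists a s, [/\ a \in S, s \in S, ~ ideal_set P s & x = a / s])
  (x \in R).
Proof.
apply: (iffP (asboolP _)) => [[a [s [sP ->]]]|[a [s [aS sS sP ->]]]].
  exists (val a), (val s); split; [exact: valP|exact: valP| |by []].
  by move/ideal_setE; apply/negP.
exists (exist _ a aS), (exist _ s sS); split=> //.
by apply/negP => h; apply: sP; rewrite -[s]/(val (exist _ s sS : subring_of S)); apply/ideal_setE.
Qed.

Definition loc_ideal : set K :=
  [set x | exists a s, [/\ ideal_set P a, s \in S, ~ ideal_set P s & x = a / s]].

Lemma ideal_set_neq0 s : ~ ideal_set P s -> s != 0.
Proof. by move=> sP; apply/eqP => s0; apply: sP; rewrite s0; case: (ideal_set_submod P). Qed.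

Lemma sub_loc x : x \in S -> x \in R.
Proof. by move=> xS; apply/locP; exists x, 1; rewrite rpred1 divr1; split=> //; apply: ideal_set1. Qed.

Lemma loc_inv s : s \in S -> ~ ideal_set P s -> s^-1 \in R.
Proof. by move=> sS sP; apply/locP; exists 1, s; rewrite rpred1 div1r. Qed.

Lemma loc_idealE x : x \in S -> loc_ideal x <-> ideal_set P x.
Proof.
move=> xS; split=> [[a [s [aP sS sP e]]]|xP].
  have : ideal_set P (x * s) by rewrite e divfK // ideal_set_neq0.
  by case/ideal_set_prime.
by exists x, 1; rewrite rpred1 divr1; split=> //; apply: ideal_set1.
Qed.

Lemma loc_ideal_sub : loc_ideal `<=` [set x | x \in R].
Proof.
by move=> x [a [s [/ideal_set_sub /= aS sS sP e]]]; apply/locP; exists a, s.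
Qed.

Lemma ideal_set_out s t : s \in S -> t \in S ->
  ~ ideal_set P s -> ~ ideal_set P t -> ~ ideal_set P (s * t).
Proof. by move=> sS tS sP tP /ideal_set_prime []. Qed.

Lemma loc_ideal_submod : is_submod R loc_ideal.
Proof.
have Pm := ideal_set_submod P; split.
  by exists 0, 1; rewrite rpred1 mul0r; split=> //; [case: Pm|apply: ideal_set1].
move=> r _ _ /locP [a [s [aS sS sP ->]]] [b [t [bP tS tP ->]]] [c [v [cP vS vP ->]]].
exists (a * v * b + (s * t) * c), (s * t * v).
have s0 := ideal_set_neq0 sP; have t0 := ideal_set_neq0 tP.
have v0 := ideal_set_neq0 vP.
split.
- by apply: (submodD Pm); apply: (submodM Pm); rewrite ?rpredM.
- by rewrite !rpredM.
- by apply: ideal_set_out; rewrite ?rpredM //; apply: ideal_set_out.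
by field; rewrite s0 t0 v0.
Qed.

Lemma loc_ideal1 : ~ loc_ideal 1.
Proof. by move/(loc_idealE (rpred1 _)); apply: ideal_set1. Qed.

Lemma loc_unit x : x \in R -> ~ loc_ideal x -> x^-1 \in R.
Proof.
move=> /locP [a [s [aS sS sP ->]]] h; rewrite invf_div; apply/locP.
by exists s, a; split=> // aP; apply: h; exists a, s.
Qed.

Lemma loc_ideal_principal x : ideal_set P x ->
  (forall z, ideal_set P z -> principal R x z) -> loc_ideal = principal R x.
Proof.
move=> Px h; apply/seteqP; split.
  move=> _ [a [s [aP sS sP ->]]]; rewrite mulrC.
  by apply: submodM; [exact: principal_submod|exact: loc_inv|exact: h].
apply: principal_sub; first exact: loc_ideal_submod.
by apply/loc_idealE => //; apply: ideal_set_sub Px.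
Qed.

(** A local ring whose maximal ideal is principal: the generator has length 1. *)
Lemma has_length_loc_uniformizer x : ideal_set P x ->
  (forall z, ideal_set P z -> principal R x z) -> has_length R x 1.
Proof.
move=> Px h; apply: (has_length_uniformizer loc_ideal_sub loc_ideal_submod loc_ideal1 loc_unit).
exact: loc_ideal_principal.
Qed.

Lemma has_length_loc_dual q t : ideal_set P q -> ideal_set P t ->
  (forall z, ideal_set P z -> exists u v, [/\ u \in S, v \in S & z = u * q + v * t]) ->
  ~ principal R q t -> principal R q (t * t) -> has_length R q 2.
Proof.
move=> Pq Pt h nqt qtt.
have Lq : loc_ideal q by apply/loc_idealE => //; apply: ideal_set_sub Pq.
have Lt : loc_ideal t by apply/loc_idealE => //; apply: ideal_set_sub Pt.
apply: (has_length_dual loc_ideal_sub loc_ideal_submod loc_ideal1 loc_unit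
          (loc_ideal_sub Lq) Lq _ nqt qtt).
have Lm := loc_ideal_submod.
apply/seteqP; split; last first.
  by apply: (sumset_sub Lm); apply: (principal_sub Lm).
move=> _ [a [s [aP sS sP ->]]]; have [u [v [uS vS ->]]] := h a aP.
exists (u / s * q), (v / s * t); split; last by ring.
  by exists (u / s) => //; apply/locP; exists u, s.
by exists (v / s) => //; apply/locP; exists v, s.
Qed.

End Local.
End MaximalIdealsInField.

(** Stated over an abstract index type, to keep conversion away from the type
    of maximal ideals. *)
Lemma coeff_fsum (I : choiceType) (f : I -> int) (i : I) :
  finite_set [set j | f j != 0] ->
  coeff i (\sum_(j \in setT) (<< f j *g j >> : {freeg I / int})) = f i.
Proof.
move=> fin; rewrite -(fsbig_widen [set j | f j != 0]) //; last first.
  by move=> j [_ /negP]; rewrite negbK => /eqP /= ->; rewrite freegU0.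
rewrite fsbig_finite //= raddf_sum /=.
under eq_bigr do rewrite coeffU.
have [fi|fi] := eqVneq (f i) 0.
  by rewrite fi big1 // => j _; case: eqP => [->|]; rewrite ?fi ?mul0r ?mulr0.
rewrite (bigD1_seq i) /= ?fset_uniq //; last by rewrite in_fset_set // inE.
rewrite eqxx mulr1 big1 ?addr0 // => j ji.
by rewrite (negbTE ji) mulr0.
Qed.

Lemma coset_setT (V : zmodType) (D D' : V) :
  [set D + E | E in setT] = [set D' + E | E in setT].
Proof.
apply/seteqP; split=> _ [E _ <-]; [exists (D - D' + E)|exists (D' - D + E)] => //.
all: by rewrite addrA addrC [_ + (_ - _)]addrC subrK addrC.
Qed.

Section OrdAt.
Variables (K : fieldExtType rat) (O : nf_order K).
Implicit Types P : spec_max O.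

Definition loc_length P (a : K) n := has_length (loc_pred P) a n.

Lemma local_lengthE P (a : subring_of O) n :
  loc_length P (val a) n -> local_length P a = n.
Proof. exact: (@mod_lengthE _ (loc_pred P) (to_loc P a)). Qed.

Hypothesis finite_length : forall P a, a \in O -> a != 0 -> exists n, loc_length P a n.
Hypothesis fractions : forall x : K, exists a b, [/\ a \in O, b \in O, b != 0 & x = a / b].

(** Two fractions a / b = c / d give a d = b c, and lengths are additive, so the
    difference of lengths is the same for both. *)
Lemma ord_atE P a b m n : a \in O -> b \in O -> a != 0 -> b != 0 ->
  loc_length P a m -> loc_length P b n -> ord_at P (a / b) = m%:Z - n%:Z.
Proof.
move=> aO bO a0 b0 am bn; rewrite /ord_at; case: xgetP => [z -> |].
  move=> [c [d [c0 d0 e ->]]].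
  have [k ck] := finite_length P (valP c) c0; have [l dl] := finite_length P (valP d) d0.
  rewrite (local_lengthE ck) (local_lengthE dl).
  have c0' : val c != 0 by []. have d0' : val d != 0 by [].
  have h1 := has_lengthM a0 am dl; have h2 := has_lengthM b0 bn ck.
  have e' : a * val d = b * val c.
    by rewrite -[a](divfK b0) e mulrAC divfK // mulrC.
  rewrite e' in h1; have := has_length_uniq h1 h2.
  move=> /(congr1 Posz); rewrite !PoszD => h.
  rewrite -[LHS](addrK l%:Z) addrAC subrK; apply/eqP.
  by rewrite subr_eq addrAC eq_sym subr_eq h addrC.
move=> /(_ (m%:Z - n%:Z)) []; exists (exist _ a aO), (exist _ b bO); split=> //.
by rewrite (@local_lengthE P (exist _ a aO) _ am) (@local_lengthE P (exist _ b bO) _ bn).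
Qed.

Lemma ord_at_in P a n : a \in O -> a != 0 -> loc_length P a n -> ord_at P a = n.
Proof.
move=> aO a0 an; rewrite -[a]divr1 (@ord_atE P a 1 n 0) ?rpred1 ?oner_neq0 ?subr0 //.
by apply: has_length_unit; rewrite ?invr1 ?rpred1 ?oner_neq0.
Qed.

Lemma ord_atM P x y : x != 0 -> y != 0 -> ord_at P (x * y) = ord_at P x + ord_at P y.
Proof.
move=> x0 y0; have [a [b [aO bO b0 xE]]] := fractions x.
have [c [d [cO dO d0 yE]]] := fractions y.
have a0 : a != 0 by apply: contraNneq x0 => a0; rewrite xE a0 mul0r.
have c0 : c != 0 by apply: contraNneq y0 => c0; rewrite yE c0 mul0r.
have [i ai] := finite_length P aO a0; have [j bj] := finite_length P bO b0.
have [k ck] := finite_length P cO c0; have [l dl] := finite_length P dO d0.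
rewrite {1}xE {1}yE mulf_div (ord_atE _ _ _ _ (has_lengthM a0 ai ck) (has_lengthM b0 bj dl));
  rewrite ?rpredM ?mulf_neq0 //.
rewrite xE yE (ord_atE _ _ _ _ ai bj) // (ord_atE _ _ _ _ ck dl) //.
by rewrite !PoszD opprD addrACA.
Qed.

Lemma ord_at1 P : ord_at P 1 = 0.
Proof. by apply: (addIr (ord_at P 1)); rewrite -ord_atM ?oner_neq0 // mul1r add0r. Qed.

Lemma ord_atV P x : x != 0 -> ord_at P x^-1 = - ord_at P x.
Proof.
by move=> x0; apply: (addIr (ord_at P x)); rewrite -ord_atM ?invr_neq0 // mulVf // ord_at1 addNr.
Qed.

Lemma ord_at_ge0 P a : a \in O -> a != 0 -> 0 <= ord_at P a.
Proof. by move=> aO a0; have [n an] := finite_length P aO a0; rewrite (ord_at_in aO a0 an). Qed.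

Lemma loc_length_out P a : a \in O -> ~ ideal_set P a -> loc_length P a 0.
Proof.
move=> aO aP; apply: has_length_unit; [exact: sub_loc|exact: loc_inv|].
exact: ideal_set_neq0 aP.
Qed.

Lemma ord_at_out P a : a \in O -> ~ ideal_set P a -> ord_at P a = 0.
Proof. by move=> aO aP; rewrite (ord_at_in aO _ (loc_length_out aO aP)) // (ideal_set_neq0 aP). Qed.

Hypothesis finite_support : forall a, a \in O -> a != 0 ->
  finite_set [set P : spec_max O | ideal_set P a].

(** The sum defining a divisor is meaningful because only the maximal ideals
    that contain the numerator or the denominator contribute. *)
Lemma coeff_divisor P x : x != 0 -> coeff P (divisor O x) = ord_at P x.
Proof.
move=> x0; rewrite /divisor.
have fin : finite_set [set Q : spec_max O | ord_at Q x != 0].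
  have [a [b [aO bO b0 xE]]] := fractions x.
  have a0 : a != 0 by apply: contraNneq x0 => a0; rewrite xE a0 mul0r.
  have ab0 : a * b != 0 by rewrite mulf_neq0.
  have abO : a * b \in O by rewrite rpredM.
  apply: (sub_finite_set _ (finite_support abO ab0)) => Q /= h.
  apply: contrapT => nQ; case/negP: h; rewrite xE ord_atM ?invr_neq0 // ord_atV //.
  have Qm := ideal_set_submod Q.
  have nQa : ~ ideal_set Q a.
    by move=> h; apply: nQ; rewrite mulrC; apply: submodM Qm bO h.
  have nQb : ~ ideal_set Q b by move=> h; apply: nQ; apply: submodM Qm aO h.
  by rewrite !ord_at_out // subr0.
exact: coeff_fsum.
Qed.

Lemma divisorM x y : x != 0 -> y != 0 -> divisor O (x * y) = divisor O x + divisor O y.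
Proof.
move=> x0 y0; apply/eqP/freeg_eqP => P.
by rewrite coeffD !coeff_divisor ?mulf_neq0 // ord_atM.
Qed.

Lemma principalD D E : principal_divisors O D -> principal_divisors O E ->
  principal_divisors O (D + E).
Proof.
move=> [x /= x0 <-] [y /= y0 <-]; exists (x * y); first by rewrite /= mulf_neq0.
exact: divisorM.
Qed.

Lemma principal0 : principal_divisors O 0.
Proof.
exists 1; first exact: oner_neq0.
by apply/eqP/freeg_eqP => P; rewrite coeff0 coeff_divisor ?oner_neq0 // ord_at1.
Qed.

Lemma principalN D : principal_divisors O D -> principal_divisors O (- D).
Proof.
move=> [x /= x0 <-]; exists x^-1; first by rewrite /= invr_neq0.
by apply/eqP/freeg_eqP => P; rewrite coeffN !coeff_divisor ?invr_neq0 // ord_atV.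
Qed.

Lemma principalMz D (n : int) : principal_divisors O D -> principal_divisors O (D *~ n).
Proof.
move=> hD; have nat_case k : principal_divisors O (D *+ k).
  elim: k => [|k IH]; first by rewrite mulr0n; apply: principal0.
  by rewrite mulrS; apply: principalD.
by case: n => k; [apply: nat_case|rewrite NegzE mulrNz; apply/principalN/nat_case].
Qed.

Lemma principal_supp (D : Div O) :
  (forall P, coeff P D != 0 -> principal_divisors O (<< P >> : Div O)) ->
  principal_divisors O D.
Proof.
move=> h; rewrite -[D]freeg_sumE big_seq; elim/big_ind: _ => [||P].
- exact: principal0.
- exact: principalD.
rewrite mem_dom => hP.
have -> : (<< coeff P D *g P >> : Div O) = (<< P >> : Div O) *~ coeff P D.
  by rewrite freegU_mulz intz.
by apply: principalMz; apply: h.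
Qed.

(** The divisor of x differs from P by primes already known to be principal. *)
Lemma principal_of_ord P x : x != 0 -> ord_at P x = 1 ->
  (forall Q, Q <> P -> ord_at Q x != 0 -> principal_divisors O (<< Q >> : Div O)) ->
  principal_divisors O (<< P >> : Div O).
Proof.
move=> x0 Px hQ.
have -> : (<< P >> : Div O) = divisor O x - (divisor O x - << P >>) by rewrite subKr.
apply: principalD; first by exists x.
apply/principalN/principal_supp => Q; rewrite coeffB coeff_divisor // coeffU mul1r.
case: (eqVneq P Q) => [<-|PQ]; first by rewrite Px subrr eqxx.
by rewrite subr0; apply: hQ => QP; rewrite QP eqxx in PQ.
Qed.

Lemma Chow_trivialI : (forall P, principal_divisors O (<< P >> : Div O)) -> Chow_trivial O.
Proof.
move=> h; have hD (D : Div O) : principal_divisors O D by apply: principal_supp => P _; apply: h.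
apply/seteqP; split=> [_ [D _ <-]|_ ->]; last by exists 0.
have eT : principal_divisors O = setT by apply/seteqP; split=> // E _; apply: hD.
rewrite /chow_coset eT.
exact: coset_setT.
Qed.

End OrdAt.

(** * The orders of a quadratic field *)

Section QuadraticField.
Variables (K : fieldExtType rat) (w : K) (p e : nat).
Hypothesis pE : (p.+1 = 4 * e)%N.
Hypothesis p_pr : prime p.
Hypothesis wE : w * w = w - e%:R.
Hypothesis dimK : \dim {:K} = 2%N.
Local Notation N := (qnorm e%:Z).

Definition quad (a b : rat) : K := in_alg K a + in_alg K b * w.

Lemma quadD a b c d : quad a b + quad c d = quad (a + c) (b + d).
Proof. by rewrite /quad !rmorphD /=; ring. Qed.

Lemma quadM a b c d : quad a b * quad c d = quad (a * c - e%:R * b * d) (a * d + b * c + b * d).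
Proof.
transitivity (in_alg K a * in_alg K c + (in_alg K a * in_alg K d +
  in_alg K b * in_alg K c) * w + in_alg K b * in_alg K d * (w * w)).
  by rewrite /quad; ring.
by rewrite wE /quad !rmorphD !rmorphN !rmorphM rmorph_nat; ring.
Qed.

(** The norm form is definite over the rationals: four times its value is
    (2a + b)^2 + p b^2. *)
Lemma quad_eq0 a b : quad a b = 0 -> a = 0 /\ b = 0.
Proof.
move=> h; have : quad a b * quad (a + b) (- b) = 0 by rewrite h mul0r.
rewrite quadM /quad.
have -> : a * - b + b * (a + b) + b * - b = 0 by ring.
rewrite rmorph0 mul0r addr0 => /eqP; rewrite fmorph_eq0 => /eqP h0.
have e0 : (0 : rat) < e%:R by rewrite ltr0n; clear -pE; lia.
have p0 : (0 : rat) < p%:R by rewrite ltr0n prime_gt0.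
have pe : p%:R = 4 * e%:R - 1 :> rat by rewrite -natrM -pE -addn1 natrD addrK.
have h4 : (2 * a + b) ^+ 2 + p%:R * b ^+ 2 = 0.
  by rewrite pe -[RHS](mulr0 4) -[in RHS]h0; ring.
have h5 : 0 <= p%:R * b ^+ 2 by rewrite mulr_ge0 ?sqr_ge0 // ltW.
move/eqP: h4; rewrite (paddr_eq0 (sqr_ge0 _) h5).
rewrite sqrf_eq0 mulf_eq0 sqrf_eq0 (gt_eqF p0) /= => /andP[/eqP h1 /eqP b0].
by move: h1; rewrite b0 addr0 => /eqP; rewrite mulf_eq0 => /orP[//|/eqP].
Qed.

Lemma quad_inj a b c d : quad a b = quad c d -> a = c /\ b = d.
Proof.
move=> h; have : quad (a - c) (b - d) = 0.
  by rewrite -quadD h /quad !rmorphN; ring.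
by move=> /quad_eq0 [/subr0_eq -> /subr0_eq ->].
Qed.

Lemma basis_1w (c : rat) : c != 0 -> basis_of {:K} [:: 1; quad 0 c].
Proof.
move=> c0; pose X := [tuple 1; quad 0 c].
rewrite -[[:: _; _]]/(X : seq K) basisEfree; apply/and3P; split.
- apply/freeP => k; rewrite !big_ord_recl big_ord0 /= addr0 => h.
  have : quad (k ord0) (k (fintype.lift ord0 ord0) * c) = 0.
    apply: etrans h; rewrite /quad rmorph0 add0r -[_ *: (_ * _)]mulr_algl.
    by rewrite (rmorphM (in_alg K)) mulrA.
  move=> /quad_eq0 [h0 /eqP]; rewrite mulf_eq0 (negbTE c0) orbF => /eqP h1.
  by case=> -[|[|//]] hi; [rewrite -h0|rewrite -h1]; congr k; apply: val_inj.
- exact: subvf.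
- by rewrite dimK.
Qed.

Lemma quad_surj (z : K) : exists ab : rat * rat, z = quad ab.1 ab.2.
Proof.
have b : basis_of {:K} [tuple 1; quad 0 1] by apply: basis_1w; apply: oner_neq0.
have := coord_basis b (memvf z).
rewrite !big_ord_recl big_ord0 /= addr0; set c := coord _ _ z; set d := coord _ _ z.
move=> ->; exists (c, d).
by rewrite /quad rmorph0 add0r rmorph1 mul1r -[d *: w]mulr_algl.
Qed.

Definition quad_coord (z : K) : rat * rat := projT1 (cid (quad_surj z)).

Lemma quad_coordK z : quad (quad_coord z).1 (quad_coord z).2 = z.
Proof. exact: (esym (projT2 (cid (quad_surj z)))). Qed.

Definition qconj (z : K) : K := let: (a, b) := quad_coord z in quad (a + b) (- b).

Lemma qconjE a b : qconj (quad a b) = quad (a + b) (- b).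
Proof.
rewrite /qconj; case E : (quad_coord (quad a b)) => [c d].
by have := quad_coordK (quad a b); rewrite E => /quad_inj /= [-> ->].
Qed.

Lemma qconjK : involutive qconj.
Proof. by move=> z; rewrite -[z]quad_coordK !qconjE opprK addrK. Qed.

Lemma qconjD : {morph qconj : x y / x + y}.
Proof.
move=> x y; rewrite -[x]quad_coordK -[y]quad_coordK; move: (quad_coord x) (quad_coord y) => [a b] [c d] /=.
by rewrite quadD !qconjE quadD; congr quad; ring.
Qed.

Lemma qconjM : {morph qconj : x y / x * y}.
Proof.
move=> x y; rewrite -[x]quad_coordK -[y]quad_coordK; move: (quad_coord x) (quad_coord y) => [a b] [c d] /=.
by rewrite quadM !qconjE quadM; congr quad; ring.
Qed.

Definition quadz (x y : int) : K := x%:~R + y%:~R * w.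

Lemma quadzE x y : quadz x y = quad x%:~R y%:~R.
Proof. by rewrite /quad !rmorph_int. Qed.

Lemma quadz_inj x y x' y' : quadz x y = quadz x' y' -> x = x' /\ y = y'.
Proof.
rewrite !quadzE => /quad_inj [/eqP h1 /eqP h2]; move: h1 h2.
by rewrite !eqr_int => /eqP -> /eqP ->.
Qed.

Lemma quadzD a b c d : quadz a b + quadz c d = quadz (a + c) (b + d).
Proof. by rewrite !quadzE quadD !rmorphD. Qed.

Lemma quadzN a b : - quadz a b = quadz (- a) (- b).
Proof. by rewrite /quadz !rmorphN; ring. Qed.

Lemma quadzM a b c d : quadz a b * quadz c d = quadz (a * c - e%:Z * b * d) (a * d + b * c + b * d).
Proof. by rewrite !quadzE quadM; congr quad; rewrite ?rmorphD ?rmorphN ?rmorphM /=; ring. Qed.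

Lemma quadz0 a : quadz a 0 = a%:~R.
Proof. by rewrite /quadz mul0r addr0. Qed.

Lemma qconj_quadz a b : qconj (quadz a b) = quadz (a + b) (- b).
Proof. by rewrite !quadzE qconjE rmorphD rmorphN. Qed.

Lemma quadz_norm a b : quadz a b * qconj (quadz a b) = (N a b)%:~R.
Proof. by rewrite qconj_quadz quadzM -quadz0; congr quadz; rewrite /qnorm; ring. Qed.

Lemma intK_eq0 (n : int) : (n%:~R == 0 :> K) = (n == 0).
Proof.
apply/eqP/eqP => [|->]; last by rewrite mulr0z.
by rewrite -quadz0 -[RHS](quadz0 0) => /quadz_inj [].
Qed.

Lemma quadz_eq0 a b : (quadz a b == 0) = (a == 0) && (b == 0).
Proof.
apply/eqP/andP => [|[/eqP -> /eqP ->]]; last by rewrite quadz0.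
by rewrite -[RHS](quadz0 0) => /quadz_inj [-> ->].
Qed.

Section Order.
Variable f : nat.
Hypothesis f_gt0 : (0 < f)%N.

Definition quadratic_order_pred : {pred K} :=
  fun z => `[< exists x y : int, z = quadz x (f%:Z * y) >].

Lemma quadratic_order_predP z :
  reflect (exists x y : int, z = quadz x (f%:Z * y)) (z \in quadratic_order_pred).
Proof. exact: asboolP. Qed.

Lemma quadratic_order_is_order : is_order quadratic_order_pred.
Proof.
split.
- split.
  + by apply/quadratic_order_predP; exists 1, 0; rewrite mulr0 quadz0.
  + move=> _ _ /quadratic_order_predP [x [y ->]] /quadratic_order_predP [x' [y' ->]]; apply/quadratic_order_predP.
    by exists (x - x'), (y - y'); rewrite quadzN quadzD; congr quadz; ring.
  + move=> _ _ /quadratic_order_predP [x [y ->]] /quadratic_order_predP [x' [y' ->]]; apply/quadratic_order_predP.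
    exists (x * x' - e%:Z * (f%:Z * y) * (f%:Z * y')), (x * y' + y * x' + f%:Z * y * y').
    by rewrite quadzM; congr quadz; ring.
- exists 2%N, [tuple 1; quadz 0 f%:Z] => z; split.
    move=> /quadratic_order_predP [x [y ->]]; exists [ffun i => if i == ord0 then x else y].
    rewrite !big_ord_recl big_ord0 /= !ffunE /= addr0 /quadz mulr0z add0r.
    by rewrite -[X in _ = _ + X]mulrzl rmorphM /=; ring.
  case=> a ->; apply/quadratic_order_predP; exists (a ord0), (a (fintype.lift ord0 ord0)).
  rewrite !big_ord_recl big_ord0 /= addr0 /quadz mulr0z add0r.
  by rewrite -[X in _ + X = _]mulrzl rmorphM /=; ring.
exists [:: 1; quadz 0 f%:Z].
  by rewrite quadzE; apply: basis_1w; rewrite intr_eq0; lia.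
have h1 : 1 \in quadratic_order_pred by apply/quadratic_order_predP; exists 1, 0; rewrite mulr0 quadz0.
have h2 : quadz 0 f%:Z \in quadratic_order_pred.
  by apply/quadratic_order_predP; exists 0, 1; rewrite mulr1.
by move=> z; rewrite in_cons mem_seq1 => /orP[]/eqP ->.
Qed.

Definition quadratic_order : nf_order K := Order quadratic_order_is_order.

Local Notation O := quadratic_order.

Lemma quadratic_orderP z : reflect (exists x y : int, z = quadz x (f%:Z * y)) (z \in O).
Proof. exact: quadratic_order_predP. Qed.

Lemma qconj_in z : z \in O -> qconj z \in O.
Proof.
move=> /quadratic_orderP [x [y ->]]; apply/quadratic_orderP; exists (x + f%:Z * y), (- y).
by rewrite qconj_quadz mulrN.
Qed.

Lemma quadz_in x y : quadz x (f%:Z * y) \in O.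
Proof. by apply/quadratic_orderP; exists x, y. Qed.

Lemma int_in (n : int) : n%:~R \in O.
Proof. by rewrite -quadz0 -(mulr0 f%:Z) quadz_in. Qed.

Lemma quadratic_order_fractions (z : K) : exists a b, [/\ a \in O, b \in O, b != 0 & z = a / b].
Proof.
rewrite -[z]quad_coordK; case: (quad_coord z) => a b /=.
exists (quadz (f%:Z * numq a * denq b) (f%:Z * (numq b * denq a))), (f%:Z * denq a * denq b)%:~R.
split; [exact: quadz_in|exact: int_in| |].
  by rewrite intK_eq0 !mulf_neq0 ?denq_neq0 //; lia.
have h : (f%:Z * denq a * denq b)%:~R != 0 :> K.
  by rewrite intK_eq0 !mulf_neq0 ?denq_neq0 //; lia.
apply: (mulIf h); rewrite divfK // -quadz0 !quadzE quadM; congr quad.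
  by rewrite mulr0 subr0 !rmorphM /= -{1}[a]divq_num_den; field; rewrite intr_eq0 denq_neq0.
rewrite !mulr0 add0r addr0 !rmorphM /= -{1}[b]divq_num_den; field; by rewrite intr_eq0 denq_neq0.
Qed.


(** * Maximal ideals of a quadratic order *)

Implicit Types P Q : spec_max O.

Lemma idealB P x y : ideal_set P x -> ideal_set P y -> ideal_set P (x - y).
Proof. exact: submodB (ideal_set_submod P). Qed.

Lemma idealD P x y : ideal_set P x -> ideal_set P y -> ideal_set P (x + y).
Proof. exact: submodD (ideal_set_submod P). Qed.

Lemma idealM P x y : x \in O -> ideal_set P y -> ideal_set P (x * y).
Proof. exact: submodM (ideal_set_submod P). Qed.

(** A maximal ideal that contains l meets the integers in the multiples of l. *)
Lemma ideal_intE P l (n : int) : prime l -> ideal_set P l%:Z%:~R ->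
  ideal_set P n%:~R <-> (l %| n)%Z.
Proof.
move=> l_pr lP; split=> [nP|/dvdzP [m ->]]; last first.
  by rewrite rmorphM /=; apply: idealM => //; apply: int_in.
apply: contraT => nl; exfalso; apply: (@ideal_set1 _ _ P).
have /coprimezP [[u v] /= uv] : coprimez l n by rewrite coprimezE prime_coprime.
have -> : 1 = u%:~R * l%:Z%:~R + v%:~R * n%:~R :> K.
  by rewrite -!rmorphM -rmorphD /= uv.
by apply: idealD; apply: idealM => //; apply: int_in.
Qed.

Lemma norm_int z : z \in O -> z != 0 ->
  exists2 n : nat, (0 < n)%N & z * qconj z = n%:Z%:~R.
Proof.
move=> /quadratic_orderP [x [y ->]] z0; rewrite quadz_norm.
have : 0 < N x (f%:Z * y).
  by apply: (qnorm_gt0 pE p_pr); rewrite -negb_and -quadz_eq0.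
by case: (N x _) => // n n0; exists n.
Qed.

(** A maximal ideal is prime, so it contains a prime factor of any positive
    integer in it. *)
Lemma prime_in_of_nat P n : (0 < n)%N -> ideal_set P n%:Z%:~R ->
  exists l, [/\ prime l, (l %| n)%N & ideal_set P l%:Z%:~R].
Proof.
elim/ltn_ind: n => n IH n0 nP.
have [n1|n1] := leqP n 1.
  have e1 : n = 1%N by apply/eqP; rewrite eqn_leq n1.
  by case: (@ideal_set1 _ _ P); rewrite e1 in nP.
have [m nE] := dvdnP (pdiv_dvd n); have l_pr := pdiv_prime n1.
have : ideal_set P (m%:Z%:~R * (pdiv n)%:Z%:~R) by rewrite -rmorphM -PoszM -nE.
case/ideal_set_prime; [exact: int_in|exact: int_in| |].
  move=> mP; have m0 : (0 < m)%N by move: n0; rewrite {1}nE muln_gt0 => /andP[].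
  have [|l [l1 l2 l3]] := IH m _ m0 mP.
    by rewrite [X in (_ < X)%N]nE ltn_Pmulr // prime_gt1.
  by exists l; split=> //; rewrite nE dvdn_mulr.
by move=> lP; exists (pdiv n); rewrite pdiv_dvd.
Qed.

(** The zero ideal is not maximal: if 2 is not in P, write 1 = 2 r + u with u in
    P.  Then u is nonzero since 2 is not invertible in the order, and its norm is
    a positive integer in P. *)
Lemma exists_prime P : exists l, prime l /\ ideal_set P l%:Z%:~R.
Proof.
have [h|n2] := pselect (ideal_set P 2%:Z%:~R); first by exists 2%N.
have [r [u [rO uP e1]]] := ideal_set_comaximal (int_in 2) n2.
have u0 : u != 0.
  apply/eqP => u0; move: e1; rewrite u0 addr0.
  have [x [y ->]] := quadratic_orderP _ rO.
  rewrite -quadz0 quadzM -[RHS](quadz0 1) => /quadz_inj [h _].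
  by move: h; rewrite mulr0 subr0; lia.
have uO := ideal_set_sub uP.
have [n n0 nE] := norm_int uO u0.
have nP : ideal_set P n%:Z%:~R by rewrite -nE mulrC; apply: idealM => //; apply: qconj_in.
by have [l [l_pr _ lP]] := prime_in_of_nat n0 nP; exists l.
Qed.

(** A maximal ideal that contains the norm n of a is determined by its trace on
    the n^2 representatives of the order modulo n. *)
Lemma finite_support_in_order a : a \in O -> a != 0 ->
  finite_set [set P : spec_max O | ideal_set P a].
Proof.
move=> aO a0; have [n n0 nE] := norm_int aO a0.
have sub : [set P : spec_max O | ideal_set P a] `<=` [set P | ideal_set P n%:Z%:~R].
  by move=> P /= aP; rewrite -nE mulrC; apply: idealM => //; apply: qconj_in.
apply: sub_finite_set sub _.
pose G P := [set ij : 'I_n * 'I_n | `[< ideal_set P (quadz ij.1%:Z (f%:Z * ij.2%:Z)) >]]%SET.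
have nz : n%:Z != 0 by rewrite -lt0n.
have red P z : ideal_set P n%:Z%:~R -> z \in O -> exists ij : 'I_n * 'I_n,
    forall Q, ideal_set Q n%:Z%:~R -> ideal_set Q z <-> ij \in G Q.
  move=> nP /quadratic_orderP [x [y ->]].
  have b (t : int) : (absz (t %% n)%Z < n)%N.
    by have := modz_ge0 t nz; have := ltz_pmod t (_ : 0 < n%:Z); rewrite ltz_nat; lia.
  have eb t : (nat_of_ord (Ordinal (b t)))%:Z = (t %% n)%Z.
    by apply: gez0_abs; apply: modz_ge0.
  exists (Ordinal (b x), Ordinal (b y)) => Q nQ; rewrite inE.
  rewrite -[(_, _).1]/(Ordinal (b x)) -[(_, _).2]/(Ordinal (b y)) !eb.
  set z' := quadz (x %% n)%Z _.
  have zE : quadz x (f%:Z * y) - z' = quadz (x %/ n)%Z (f%:Z * (y %/ n)%Z) * n%:Z%:~R.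
    rewrite /z' quadzN quadzD -quadz0 quadzM.
    have ex := divz_eq x n; have ey := divz_eq y n.
    move: (x %/ n)%Z (x %% n)%Z (y %/ n)%Z (y %% n)%Z ex ey => x1 x2 y1 y2 -> ->.
    by congr quadz; ring.
  have dQ : ideal_set Q (quadz x (f%:Z * y) - z').
    by rewrite zE; apply: idealM => //; apply: quadz_in.
  split=> [h|/asboolP h]; last by rewrite -(subrK z' (quadz x _)); apply: idealD.
  by apply/asboolP; rewrite -[z'](subKr (quadz x (f%:Z * y))); apply: idealB.
have inj : {in [set P | ideal_set P n%:Z%:~R] &, injective G}.
  move=> P Q; rewrite !inE /= => nP nQ eG; apply: ideal_set_inj => z zP.
  have [ij h] := red P z nP (ideal_set_sub zP).
  by apply/(h Q nQ); rewrite -eG; apply/(h P nP).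
by rewrite -(eq_finite_set (inj_card_eq inj)); apply: finite_finset.
Qed.


Lemma qconj_int (n : int) : qconj n%:~R = n%:~R.
Proof. by rewrite -quadz0 qconj_quadz addr0 oppr0. Qed.

Lemma qconj0 : qconj 0 = 0. Proof. exact: (qconj_int 0). Qed.

Lemma qconj_eq0 z : (qconj z == 0) = (z == 0).
Proof. by rewrite -[X in _ == X]qconj0 (can_eq qconjK). Qed.

Lemma qconj_div a b : b != 0 -> qconj (a / b) = qconj a / qconj b.
Proof.
move=> b0; have b0' : qconj b != 0 by rewrite qconj_eq0.
by apply: (mulIf b0'); rewrite -qconjM !divfK.
Qed.

Section Singular.
Variables (q : nat) (Q : spec_max O).
Hypothesis q_pr : prime q.
Hypothesis qf : (q %| f)%N.
Hypothesis qQ : ideal_set Q q%:Z%:~R.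

(** When q divides f, the element f w is nilpotent modulo q. *)
Lemma fw_sqr : quadz 0 f * quadz 0 f =
  quadz (- (e%:Z * (f %/ q)%N * f)) (f%:Z * (f %/ q)%N) * q%:Z%:~R.
Proof.
have fE : f%:Z = (f %/ q)%N%:Z * q by rewrite -PoszM divnK.
rewrite quadzM -[q%:Z%:~R]quadz0 quadzM; move: (f %/ q)%N fE => k fE.
by congr quadz; rewrite ?[in LHS]fE fE; ring.
Qed.

Lemma singular_fw : ideal_set Q (quadz 0 f).
Proof.
have fwO : quadz 0 f \in O by rewrite -[X in quadz _ X](mulr1 f%:Z) quadz_in.
have : ideal_set Q (quadz 0 f * quadz 0 f).
  by rewrite fw_sqr; apply: idealM => //; apply: quadz_in.
by case/ideal_set_prime.
Qed.

Lemma singularE a b : ideal_set Q (quadz a (f%:Z * b)) <-> (q %| a)%Z.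
Proof.
have bw : ideal_set Q (quadz 0 (f%:Z * b)).
  have -> : quadz 0 (f%:Z * b) = b%:~R * quadz 0 f by rewrite -quadz0 quadzM; congr quadz; ring.
  by apply: idealM; [apply: int_in|apply: singular_fw].
rewrite -(ideal_intE _ q_pr qQ); split=> h.
  by have := idealB h bw; rewrite quadzN quadzD subr0 subrr quadz0.
by have := idealD h bw; rewrite -quadz0 quadzD addr0 add0r.
Qed.

Lemma singular_conj z : ideal_set Q z -> ideal_set Q (qconj z).
Proof.
move=> zQ; have [x [y zE]] := quadratic_orderP _ (ideal_set_sub zQ).
move: zQ; rewrite zE qconj_quadz -mulrN.
move=> /singularE xq; apply/singularE; apply: rpredD => //.
by rewrite dvdz_mulr.
Qed.

Lemma singular_loc_conj r : r \in loc_pred Q -> qconj r \in loc_pred Q.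
Proof.
move=> /locP [a [s [aO sO sQ ->]]]; apply/locP; exists (qconj a), (qconj s).
split; [exact: qconj_in|exact: qconj_in| |].
  by move=> /singular_conj; rewrite qconjK.
by rewrite qconj_div // (ideal_set_neq0 sQ).
Qed.

(** Locally O / q O is F_q[t] / (t^2), with t the class of f w. *)
Lemma singular_length : loc_length Q q%:Z%:~R 2.
Proof.
apply: (has_length_loc_dual (t := quadz 0 f)) => //; first exact: singular_fw.
- move=> z zQ; have [x [y zE]] := quadratic_orderP _ (ideal_set_sub zQ); rewrite zE in zQ *.
  have /dvdzP [x' ->] := (singularE x y).1 zQ.
  exists x'%:~R, y%:~R; split; [exact: int_in|exact: int_in|].
  by rewrite -!quadz0 !quadzM quadzD; congr quadz; ring.
- move=> [_ /locP [a [s [/quadratic_orderP [c [d ->]] /quadratic_orderP [x [y ->]] sQ ->]]] h].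
  apply: sQ; apply/singularE.
  have s0 : quadz x (f%:Z * y) != 0.
    apply: contraPneq h => ->; rewrite invr0 mulr0 mul0r => /eqP.
    by rewrite quadz_eq0 /=; lia.
  have : quadz 0 f * quadz x (f%:Z * y) = quadz c (f%:Z * d) * q%:Z%:~R.
    by rewrite h mulrAC divfK.
  rewrite -quadz0 !quadzM => /quadz_inj [_ h2].
  have h3 : f%:Z * (x + f%:Z * y) = f%:Z * (d * q%:Z).
    by move: h2; rewrite !(mul0r, mulr0, add0r, addr0) => h2; rewrite mulrA -h2; ring.
  have fz : f%:Z != 0 by lia.
  have h4 := mulfI fz h3.
  have -> : x = d * q%:Z - f%:Z * y by rewrite -h4 addrK.
  by apply: rpredB; [apply: dvdz_mull|apply: dvdz_mulr].
exists (quadz (- (e%:Z * (f %/ q)%N * f)) (f%:Z * (f %/ q)%N)); last exact: fw_sqr.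
by apply/sub_loc/quadz_in.
Qed.

End Singular.

Lemma singular_uniq q P Q : prime q -> (q %| f)%N ->
  ideal_set P q%:Z%:~R -> ideal_set Q q%:Z%:~R -> P = Q.
Proof.
move=> q_pr qf qP qQ; apply: ideal_set_inj => z zP.
have [x [y zE]] := quadratic_orderP _ (ideal_set_sub zP); rewrite zE in zP *.
exact: (singularE q_pr qf qQ x y).2 ((singularE q_pr qf qP x y).1 zP).
Qed.

Section NonSingular.
Variables (l : nat) (P : spec_max O).
Hypothesis l_pr : prime l.
Hypothesis lf : ~~ (l %| f)%N.
Hypothesis lP : ideal_set P l%:Z%:~R.

(** If all elements of P have second coordinate divisible by l then P is
    generated by l: the prime is inert.  Otherwise some element can be normalized
    to f (r + w), and then l divides its norm f^2 N(r, 1). *)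
Lemma nonsingular_cases :
  (forall z, ideal_set P z -> exists2 t, t \in O & z = t * l%:Z%:~R) \/
  (exists r : nat, [/\ (r < l)%N, (l %| N r 1)%Z & ideal_set P (quadz (f%:Z * r) f)]).
Proof.
have lz : l%:Z != 0 by rewrite -lt0n prime_gt0.
have [[x [y [xyP ly]]]|no] := pselect (exists x y, ideal_set P (quadz x (f%:Z * y)) /\ ~~ (l %| y)%Z).
  right; have /coprimezP [[u v] /= uv] : coprimez l y by rewrite coprimezE prime_coprime.
  have /coprimezP [[h g] /= hg] : coprimez l f by rewrite coprimezE prime_coprime.
  (* v inverts y mod l and g inverts f mod l. *)
  pose r0 := g * v * x; pose r := absz (r0 %% l)%Z.
  have rE : r%:Z = (r0 %% l)%Z by apply: gez0_abs; apply: modz_ge0.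
  have rP : ideal_set P (quadz (f%:Z * r) f).
    have e1 : quadz (f%:Z * r) f - v%:~R * quadz x (f%:Z * y) =
       quadz (- (h * (v * x) + f%:Z * (r0 %/ l)%Z)) (f%:Z * u) * l%:Z%:~R.
      have rE' : r%:Z = g * v * x - (r0 %/ l)%Z * l 
        by rewrite rE -[g * v * x]/r0 [X in _ = X - _](divz_eq r0 l) addrAC subrr add0r.
      rewrite -!quadz0 !quadzM quadzN quadzD rE'; move: (r0 %/ l)%Z => k; congr quadz.
        transitivity (f%:Z * g * v * x - v * x - f%:Z * k * l%:Z); first by ring.
        have -> : f%:Z * g = 1 - h * l%:Z by rewrite -hg; ring.
        by ring.
      transitivity (f%:Z * (1 - v * y)); first by ring.
      by rewrite -uv; ring.
    rewrite -(subrK (v%:~R * quadz x (f%:Z * y)) (quadz _ _)) e1; apply: idealD.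
      by apply: idealM => //; apply: quadz_in.
    by apply: idealM => //; apply: int_in.
  exists r; split=> //.
    by have := ltz_pmod r0 (_ : 0 < l%:Z); rewrite -rE !ltz_nat prime_gt0 // => ->.
  have piO : quadz (f%:Z * r) f \in O by apply: ideal_set_sub rP.
  have : ideal_set P (N (f%:Z * r) f)%:~R.
    by rewrite -quadz_norm mulrC; apply: idealM => //; apply: qconj_in.
  move/(ideal_intE _ l_pr lP).
  have -> : N (f%:Z * r) f = f%:Z * f%:Z * N r 1 by rewrite /qnorm; ring.
  by rewrite Gauss_dvdzr // coprimezMr coprimezE /= prime_coprime // lf.
left=> z zP; have [x [y zE]] := quadratic_orderP _ (ideal_set_sub zP); rewrite zE in zP *.
have /dvdzP [y' yE] : (l %| y)%Z.
  by apply: contraT => ly; case: no; exists x, y.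
have e1 : quadz x (f%:Z * y) = x%:~R + quadz 0 (f%:Z * y') * l%:Z%:~R.
  by rewrite -!quadz0 quadzM quadzD yE; congr quadz; ring.
have : ideal_set P x%:~R.
  have -> : x%:~R = quadz x (f%:Z * y) - quadz 0 (f%:Z * y') * l%:Z%:~R by rewrite e1 addrK.
  by apply: idealB => //; apply: idealM => //; apply: quadz_in.
move/(ideal_intE _ l_pr lP) => /dvdzP [x' xE].
exists (quadz x' (f%:Z * y')); first exact: quadz_in.
by rewrite -quadz0 quadzM yE xE; congr quadz; ring.
Qed.

Lemma inert_length :
  (forall z, ideal_set P z -> exists2 t, t \in O & z = t * l%:Z%:~R) ->
  loc_length P l%:Z%:~R 1.
Proof.
move=> h; apply: has_length_loc_uniformizer => // z /h [t tO ->].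
by exists t => //; apply: sub_loc.
Qed.

Section Split.
Variables (r c : nat).
Hypothesis cE : N r 1 = c%:Z * l%:Z.
Hypothesis lc : ~~ (l %| c)%N.
Local Notation pi := (quadz (f%:Z * r) f).
Hypothesis piP : ideal_set P pi.

(** Away from f and c this makes f (r + w) divide l, so that it generates P
    locally. *)
Lemma split_norm : pi * qconj pi = (f * f * c)%N%:Z%:~R * l%:Z%:~R.
Proof.
have NE : N (f%:Z * r) f = (f * f * c)%N%:Z * l%:Z.
  have -> : N (f%:Z * r) f = f%:Z * f%:Z * N r 1 by rewrite /qnorm; ring.
  by rewrite cE !PoszM; ring.
by rewrite quadz_norm NE rmorphM.
Qed.

Lemma split_out : ~ ideal_set P (f * f * c)%N%:Z%:~R.
Proof.
move/(ideal_intE _ l_pr lP); rewrite dvdzE /= !Euclid_dvdM //.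
by rewrite (negbTE lf) (negbTE lc).
Qed.

Lemma split_gen z : ideal_set P z ->
  exists a b, [/\ a \in O, b \in O & z = a * pi + b * l%:Z%:~R].
Proof.
move=> zP; have [x [y zE]] := quadratic_orderP _ (ideal_set_sub zP); rewrite zE in zP *.
have e1 : quadz x (f%:Z * y) - y%:~R * pi = (x - f%:Z * r * y)%:~R.
  by rewrite -!quadz0 quadzM quadzN quadzD; congr quadz; ring.
have : ideal_set P (x - f%:Z * r * y)%:~R.
  by rewrite -e1; apply: idealB => //; apply: idealM => //; apply: int_in.
move/(ideal_intE _ l_pr lP) => /dvdzP [t tE].
exists y%:~R, t%:~R; split; [exact: int_in|exact: int_in|].
have -> : t%:~R * l%:Z%:~R = (x - f%:Z * r * y)%:~R :> K by rewrite tE rmorphM.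
by rewrite -e1 addrC subrK.
Qed.

Lemma split_length : loc_length P pi 1.
Proof.
apply: has_length_loc_uniformizer => // z /split_gen [a [b [aO bO ->]]].
have fc0 := ideal_set_neq0 split_out.
exists (a + b * (qconj pi / (f * f * c)%N%:Z%:~R)).
  have piO : pi \in O := ideal_set_sub piP.
  have fcR := loc_inv (int_in _) split_out.
  apply: rpredD; first exact: sub_loc.
  apply: rpredM; first exact: sub_loc.
  by apply: rpredM => //; apply/sub_loc/qconj_in.
rewrite mulrDl; congr (_ + _); rewrite -mulrA; congr (_ * _).
by rewrite mulrAC [qconj _ * _]mulrC split_norm mulrAC divff // mul1r.
Qed.

End Split.
End NonSingular.


(** * Triviality of the Chow group *)

Hypothesis f_split : forall q, prime q -> (q %| f)%N ->
  q != p /\ exists r : int, (q %| N r 1)%Z.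
Hypothesis f_saturated : forall l (r : int), prime l -> ~~ (l %| f)%N ->
  (l %| N r 1)%Z -> (p <= l)%N.

(** Here e < p <= l, so N(r, 1) = r^2 + r + e < l^2. *)
Lemma small_cofactor l (r : nat) : prime l -> ~~ (l %| f)%N -> (r < l)%N ->
  (l %| N r 1)%Z -> exists c : nat, [/\ N r 1 = c%:Z * l%:Z, (0 < c)%N & (c < l)%N].
Proof.
move=> l_pr lf rl lN; have pl := f_saturated l_pr lf lN.
have /dvdzP [d dE] := lN.
have N0 : 0 < N r 1 by apply: (qnorm_gt0 pE p_pr); rewrite oner_neq0 orbT.
have l0 : 0 < l%:Z by rewrite ltz_nat prime_gt0.
have Nl : N r 1 < l%:Z * l%:Z.
  have h1 : r%:Z * (r%:Z + 1) <= (l%:Z - 1) * l%:Z by apply: ler_pM; lia.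
  by rewrite /qnorm; lia.
move: N0 Nl; rewrite dE pmulr_lgt0 // ltr_pM2r // => d0 dl.
by exists (absz d); rewrite gtz0_abs //; split=> //; lia.
Qed.

Lemma qconj_split_gen (r : nat) : qconj (quadz (f%:Z * r) f) =
  (f%:Z * (2 * r%:Z + 1))%:~R - quadz (f%:Z * r) f.
Proof. by rewrite qconj_quadz quadzN -quadz0 quadzD; congr quadz; ring. Qed.

(** Lengths are known for uniformizers.  If P is not l O, the uniformizer
    f (r + w) and its conjugate have product l times an integer outside P; if the
    conjugate also lies in P, so does the trace, and then the square of the
    uniformizer is l times an element outside P. *)
Lemma finite_length_prime P l : prime l -> exists n, loc_length P l%:Z%:~R n.
Proof.
move=> l_pr; have [lP|nlP] := pselect (ideal_set P l%:Z%:~R); last first.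
  by exists 0%N; apply: loc_length_out => //; apply: int_in.
have l0 : l%:Z%:~R != 0 :> K by rewrite intK_eq0 -lt0n prime_gt0.
have [lf|lf] := boolP (l %| f)%N; first by exists 2%N; apply: singular_length.
have [inert|[r [rl lN piP]]] := nonsingular_cases l_pr lf lP.
  by exists 1%N; apply: inert_length.
have [c [cE c0 cl]] := small_cofactor l_pr lf rl lN.
have lc : ~~ (l %| c)%N by apply: contraL cl => /(dvdn_leq c0); rewrite -leqNgt.
have len1 := split_length l_pr lf lP cE lc piP.
have nrm := split_norm cE; have cpiE := qconj_split_gen r.
set pi := quadz _ _ in piP len1 nrm cpiE.
have piO : pi \in O := ideal_set_sub piP.
have pi0 : pi != 0.
  rewrite quadz_eq0 negb_and; apply/orP; right; rewrite -lt0n; exact: f_gt0.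
have [cpiP|cpiP] := pselect (ideal_set P (qconj pi)).
  have : ideal_set P (f%:Z * (2 * r%:Z + 1))%:~R.
    by rewrite -(subrK pi (_%:~R)) -cpiE; apply: idealD.
  move/(ideal_intE _ l_pr lP); rewrite Gauss_dvdzr; last by rewrite coprimezE /= prime_coprime.
  move=> /dvdzP [t tE].
  pose u := (f%:Z * t)%:~R * pi - (f * f * c)%N%:Z%:~R.
  have ftpi : ideal_set P ((f%:Z * t)%:~R * pi) by apply: idealM => //; apply: int_in.
  have uO : u \in O by rewrite rpredB ?rpredM ?int_in.
  have e2 : pi * pi = l%:Z%:~R * u.
    have -> : pi * pi = (f%:Z * (2 * r%:Z + 1))%:~R * pi - pi * qconj pi.
      by rewrite cpiE; ring.
    rewrite nrm /u; have -> : (f%:Z * (2 * r%:Z + 1))%:~R = (f%:Z * t)%:~R * l%:Z%:~R :> K.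
      by rewrite tE mulrA rmorphM.
    by rewrite mulrBr mulrA; congr (_ * _ - _); exact: mulrC.
  have len2 : loc_length P (l%:Z%:~R * u) 2.
    by rewrite -e2; apply: (has_lengthM pi0 len1 len1).
  by apply: has_length_dvd len2; rewrite ?sub_loc ?int_in.
have e2 : pi * qconj pi = l%:Z%:~R * (f * f * c)%N%:Z%:~R by rewrite nrm mulrC.
have len2 : loc_length P (l%:Z%:~R * (f * f * c)%N%:Z%:~R) 1.
  rewrite -e2 -[1%N]addn0; apply: (has_lengthM pi0 len1).
  by apply: loc_length_out => //; apply: qconj_in.
by apply: has_length_dvd len2; rewrite ?sub_loc ?int_in.
Qed.

Lemma finite_length_nat P n : (0 < n)%N -> exists k, loc_length P n%:Z%:~R k.
Proof.
elim/ltn_ind: n => n IH n0; have [n1|n1] := leqP n 1.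
  have -> : n = 1%N by apply/eqP; rewrite eqn_leq n1.
  by exists 0%N; apply: loc_length_out; [apply: int_in|apply: ideal_set1].
have [m nE] := dvdnP (pdiv_dvd n); have l_pr := pdiv_prime n1.
have m0 : (0 < m)%N by move: n0; rewrite {1}nE muln_gt0 => /andP[].
have mn : (m < n)%N by rewrite [X in (_ < X)%N]nE ltn_Pmulr // prime_gt1.
have [i mi] := IH m mn m0; have [j lj] := finite_length_prime P l_pr.
exists (i + j)%N; rewrite nE PoszM rmorphM; apply: has_lengthM mi lj.
by rewrite intK_eq0 -lt0n.
Qed.

(** It suffices to treat the norm of a, a product of rational primes. *)
Lemma finite_length_in_order P a : a \in O -> a != 0 -> exists n, loc_length P a n.
Proof.
move=> aO a0; have [n n0 nE] := norm_int aO a0.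
have [k] := finite_length_nat P n0; rewrite -nE.
by apply: has_length_dvd; rewrite ?sub_loc ?qconj_in.
Qed.

Local Notation FL := finite_length_in_order.
Local Notation FR := quadratic_order_fractions.
Local Notation FS := finite_support_in_order.

Lemma ord_atX P x n : x != 0 -> ord_at P (x ^+ n) = n%:Z * ord_at P x.
Proof.
move=> x0; elim: n => [|n IH]; first by rewrite expr0 mul0r (ord_at1 FL FR).
by rewrite exprS (ord_atM FL FR) ?expf_neq0 // IH -addn1 PoszD; ring.
Qed.

(** At a prime containing f, conjugation preserves the localization, so x + y w
    and its conjugate have the same order.  At any other prime both orders are
    nonnegative, and their sum, the order of q^k, is zero. *)
Lemma ord_norm q P x y k : prime q -> (q %| f)%N -> N x y = (q ^ k)%N%:Z ->
  2 * ord_at P (quadz x y) = k%:Z * ord_at P q%:Z%:~R.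
Proof.
move=> q_pr qf Nxy; set g := quadz x y.
have q0 : q%:Z%:~R != 0 :> K by rewrite intK_eq0 -lt0n prime_gt0.
have f0 : f%:Z%:~R != 0 :> K by rewrite intK_eq0 -lt0n.
have gg : g * qconj g = q%:Z%:~R ^+ k.
  rewrite quadz_norm Nxy -rmorphXn /=; congr (_%:~R).
  by elim: (k) => // j IH; rewrite expnS PoszM IH exprS.
have g0 : g != 0.
  by apply: contraTneq (expf_neq0 k q0) => g0; rewrite -gg g0 mul0r eqxx.
have cg0 : qconj g != 0 by rewrite qconj_eq0.
have sum : ord_at P g + ord_at P (qconj g) = k%:Z * ord_at P q%:Z%:~R.
  by rewrite -(ord_atM FL FR) // gg ord_atX.
have fgO : f%:Z%:~R * g \in O.
  have -> : f%:Z%:~R * g = quadz (f%:Z * x) (f%:Z * y).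
    by rewrite -quadz0 quadzM; congr quadz; ring.
  exact: quadz_in.
have fg0 : f%:Z%:~R * g != 0 by rewrite mulf_neq0.
have cfgE : qconj (f%:Z%:~R * g) = f%:Z%:~R * qconj g by rewrite qconjM qconj_int.
have ordfg := ord_atM FL FR P f0 g0.
have ordfcg := ord_atM FL FR P f0 cg0.
have [fP|fP] := pselect (ideal_set P f%:Z%:~R).
  have [q' [q'_pr q'f q'P]] := prime_in_of_nat f_gt0 fP.
  have [n ln] := FL P fgO fg0.
  have lcn : loc_length P (qconj (f%:Z%:~R * g)) n.
    by apply: has_length_conj qconjK qconjD qconjM _ ln => r; apply: singular_loc_conj q'P _.
  have e1 := ord_at_in FL fgO fg0 ln.
  have e2 : ord_at P (qconj (f%:Z%:~R * g)) = n.
    by apply: (ord_at_in FL _ _ lcn); rewrite ?qconj_eq0 ?qconj_in.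
  have eg : ord_at P g = ord_at P (qconj g).
    by apply: (addrI (ord_at P f%:Z%:~R)); rewrite -ordfg -ordfcg -cfgE e1 e2.
  by rewrite -sum -eg; ring.
have qP : ~ ideal_set P q%:Z%:~R.
  by move=> qP; apply: fP; apply/(ideal_intE _ q_pr qP).
have := ord_at_ge0 FL P fgO fg0.
have := ord_at_ge0 FL P (qconj_in fgO) (_ : qconj (f%:Z%:~R * g) != 0).
rewrite qconj_eq0 cfgE => /(_ fg0).
rewrite ordfg ordfcg (ord_at_out FL (int_in f) fP) !add0r => h1 h2.
move: sum h1 h2; rewrite (ord_at_out FL (int_in q) qP) mulr0.
by move: (ord_at P g) (ord_at P (qconj g)) => a b; clear; lia.
Qed.

Local Notation principal_prime P := (principal_divisors O (<< P >> : Div O)).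

(** With k odd and g of norm q^k, the element g / q^((k - 1)/2) has order
    k - (k - 1) = 1 at P and order 0 elsewhere. *)
Lemma singular_principal q P : prime q -> (q %| f)%N -> ideal_set P q%:Z%:~R ->
  principal_prime P.
Proof.
move=> q_pr qf qP; have [qp [r0 qr0]] := f_split q_pr qf.
have [k [x [y [odd_k Nxy]]]] := odd_norm_exists pE p_pr q_pr qr0 qp.
have q0 : q%:Z%:~R != 0 :> K by rewrite intK_eq0 -lt0n prime_gt0.
have g0 : quadz x y != 0.
  rewrite quadz_eq0; apply/negP => /andP[/eqP x0 /eqP y0]; move: Nxy.
  rewrite x0 y0 /qnorm !mul0r mulr0 => /esym/eqP; apply/negP.
  by rewrite -lt0n expn_gt0 prime_gt0.
have qk0 : q%:Z%:~R ^+ k./2 != 0 :> K by rewrite expf_neq0.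
have ordg Q := ord_norm Q q_pr qf Nxy.
have ordx Q : ord_at Q (quadz x y / q%:Z%:~R ^+ k./2) =
    ord_at Q (quadz x y) - (k./2)%:Z * ord_at Q q%:Z%:~R.
  by rewrite (ord_atM FL FR) ?invr_neq0 // (ord_atV FL FR) // ord_atX.
apply: (principal_of_ord FL FR FS (x := quadz x y / q%:Z%:~R ^+ k./2)).
- by rewrite mulf_neq0 ?invr_neq0.
- have := ordg P; rewrite ordx (ord_at_in FL (int_in q) q0 (singular_length q_pr qf qP)).
  have := odd_double_half k; rewrite odd_k -mul2n.
  by move: (ord_at P _) (k./2) => a j; clear; lia.
move=> Q QP; rewrite ordx; have := ordg Q.
have qQ : ~ ideal_set Q q%:Z%:~R.
  by move=> qQ; apply: QP; apply: singular_uniq q_pr qf qQ qP.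
rewrite (ord_at_out FL (int_in q) qQ) !mulr0.
by move: (ord_at Q _) => a; clear; lia.
Qed.

(** Induction on l.  For an inert prime, l itself is a generator.  Otherwise the
    norm of f (r + w) is f^2 c l with c < l: any other prime containing f (r + w)
    contains f or a prime factor of c, unless it contains l and f (r + w), and
    these generate P. *)
Lemma prime_principal l P : prime l -> ideal_set P l%:Z%:~R -> principal_prime P.
Proof.
elim/ltn_ind: l P => l IH P l_pr lP.
have [lf|lf] := boolP (l %| f)%N; first exact: singular_principal l_pr lf lP.
have l0 : l%:Z%:~R != 0 :> K by rewrite intK_eq0 -lt0n prime_gt0.
have [inert|[r [rl lN piP]]] := nonsingular_cases l_pr lf lP.
  apply: (principal_of_ord FL FR FS l0).
    by rewrite (ord_at_in FL (int_in l) l0 (inert_length lP inert)).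
  move=> Q QP ordQ; have [lQ|lQ] := pselect (ideal_set Q l%:Z%:~R).
    case: QP; apply/esym/ideal_set_inj => z /inert [t tO ->].
    exact: idealM.
  by rewrite (ord_at_out FL (int_in l) lQ) eqxx in ordQ.
have [c [cE c0 cl]] := small_cofactor l_pr lf rl lN.
have lc : ~~ (l %| c)%N by apply: contraL cl => /(dvdn_leq c0); rewrite -leqNgt.
have len1 := split_length l_pr lf lP cE lc piP.
have gen := split_gen l_pr lP piP.
have nrm := split_norm cE.
set pi := quadz _ _ in piP len1 gen nrm.
have piO : pi \in O := ideal_set_sub piP.
have pi0 : pi != 0.
  rewrite quadz_eq0 negb_and; apply/orP; right; rewrite -lt0n; exact: f_gt0.
apply: (principal_of_ord FL FR FS pi0); first by rewrite (ord_at_in FL piO pi0 len1).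
move=> Q QP ordQ; have [piQ|piQ] := pselect (ideal_set Q pi); last first.
  by rewrite (ord_at_out FL piO piQ) eqxx in ordQ.
have : ideal_set Q (f * f * c * l)%N%:Z%:~R.
  by rewrite PoszM rmorphM /= -nrm mulrC; apply: idealM => //; apply: qconj_in.
have m0 : (0 < f * f * c * l)%N by rewrite !muln_gt0 f_gt0 c0 prime_gt0.
case/(prime_in_of_nat m0) => l' [l'_pr l'm l'Q].
have [l'f|l'f] := boolP (l' %| f)%N; first exact: singular_principal l'_pr l'f l'Q.
move: l'm; rewrite !Euclid_dvdM // (negbTE l'f) /= => /orP[l'c|].
  by apply: (IH l') => //; apply: leq_ltn_trans cl; apply: dvdn_leq.
rewrite dvdn_prime2 // => /eqP e'; rewrite e' in l'Q.
case: QP; apply/esym/ideal_set_inj => z /gen [a [b [aO bO ->]]].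
by apply: idealD; apply: idealM.
Qed.

Lemma Chow_trivial_quadratic_order : Chow_trivial O.
Proof.
apply: (Chow_trivialI FL FR FS) => P; have [l [l_pr lP]] := exists_prime P.
exact: prime_principal l_pr lP.
Qed.

End Order.
End QuadraticField.

(** * The family of fields *)

(** The number 4 n! - 1 is 3 mod 4, so its prime factors, which exceed n, are
    not all 1 mod 4. *)
Lemma infinite_primes_3mod4 (n : nat) : exists p, [/\ prime p, (n < p)%N & (4 %| p.+1)%N].
Proof.
pose M := (4 * n`! - 1)%N.
have M3 : (M %% 4 = 3)%N.
  have := fact_gt0 n; rewrite /M; move: (n`!) => k k0; lia.
have M0 : (0 < M)%N by rewrite /M; have := fact_gt0 n; lia.
have [h|no] := pselect (exists p, [/\ prime p, (p %| M)%N & (p %% 4 = 3)%N]).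
  have [p [p_pr pM p3]] := h; exists p; split=> //; last first.
    by apply/dvdnP; exists (p %/ 4).+1; rewrite {1}(divn_eq p 4) p3; lia.
  rewrite ltnNge; apply/negP => pn.
  have : (p %| M.+1)%N.
    have -> : (M.+1 = 4 * n`!)%N by rewrite /M; have := fact_gt0 n; lia.
    by rewrite dvdn_mull // dvdn_fact // prime_gt0.
  by rewrite -addn1 dvdn_addr // dvdn1 => /eqP p1; rewrite p1 in p_pr.
suff : (M %% 4 = 1)%N by rewrite M3.
have Modd : odd M by lia.
clear -M0 Modd no.
elim/ltn_ind: M M0 Modd no => M IH M0 Modd no.
have [M1|M1] := leqP M 1; first by have -> : M = 1%N by lia.
have q_pr := pdiv_prime M1; have [m mE] := dvdnP (pdiv_dvd M).
move: q_pr mE; set q := pdiv M => q_pr mE.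
have m0 : (0 < m)%N by move: M0; rewrite mE muln_gt0 => /andP[].
have /andP[mo qo] : odd m && odd q by rewrite -oddM -mE.
have mM : (m < M)%N by rewrite [X in (_ < X)%N]mE ltn_Pmulr // prime_gt1.
have m1 : (m %% 4 = 1)%N.
  apply: IH => // -[p [p_pr pm p3]]; apply: no; exists p; split=> //.
  by rewrite mE dvdn_mulr.
have q1 : (q %% 4 = 1)%N.
  have q3 : (q %% 4 != 3)%N.
    apply/eqP => q3; apply: no; exists q; split=> //; exact: pdiv_dvd.
  have := odd_double_half q; have := divn_eq q 4; have := ltn_pmod q (isT : 0 < 4)%N.
  by rewrite qo -mul2n; move/eqP: q3; lia.
by rewrite mE -modnMm m1 q1.
Qed.

Definition has_root_mod (e q : nat) : bool := [exists r : 'I_q, (q %| r * r + r + e)%N].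

(** The product of the primes below p over which X^2 + X + e has a root, that
    is, of those that split in the field of discriminant -p. *)
Definition split_conductor (p e : nat) : nat :=
  (\prod_(q < p | prime q && has_root_mod e q) q)%N.

Lemma split_conductor_gt0 p e : (0 < split_conductor p e)%N.
Proof. by rewrite prodn_cond_gt0 // => q /andP[/prime_gt0]. Qed.

Lemma split_conductor_split p e q : prime q -> (q %| split_conductor p e)%N ->
  q != p /\ exists r : int, (q %| qnorm e r 1)%Z.
Proof.
move=> q_pr; rewrite /split_conductor.
elim/big_ind: _ => [|a b IHa IHb|i /andP[i_pr ri]].
- by rewrite dvdn1 => /eqP q1; rewrite q1 in q_pr.
- by rewrite Euclid_dvdM // => /orP[].
rewrite dvdn_prime2 // => /eqP ->; split; first by rewrite neq_ltn ltn_ord.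
have /existsP[r hr] := ri; exists r.
by have -> : qnorm e r 1 = (r * r + r + e)%N by rewrite /qnorm !PoszD PoszM; ring.
Qed.

Lemma split_conductor_saturated p e l (r : int) : prime l ->
  ~~ (l %| split_conductor p e)%N -> (l %| qnorm e r 1)%Z -> (p <= l)%N.
Proof.
move=> l_pr lf lN; rewrite leqNgt; apply: contra lf => lp.
have lz : l%:Z != 0 by rewrite -lt0n prime_gt0.
have l0 : 0 < l%:Z by rewrite ltz_nat prime_gt0.
have rl : (absz (r %% l)%Z < l)%N.
  by have := ltz_pmod r l0; have := modz_ge0 r lz; lia.
rewrite /split_conductor (bigD1 (Ordinal lp)) ?dvdn_mulr //= l_pr /=.
apply/existsP; exists (Ordinal rl) => /=.
rewrite -[(_ %| _)%N]/((l%:Z %| (absz (r %% l)%Z * absz (r %% l)%Z + absz (r %% l)%Z + e)%N%:Z)%Z).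
rewrite !PoszD PoszM gez0_abs ?modz_ge0 //.
have rE := divz_eq r l.
have -> : (r %% l)%Z * (r %% l)%Z + (r %% l)%Z + e%:Z =
   qnorm e r 1 - (r %/ l)%Z * (r + (r %% l)%Z + 1) * l%:Z.
  by move: (r %/ l)%Z (r %% l)%Z rE => a b ->; rewrite /qnorm; ring.
by apply: rpredB => //; apply: dvdz_mull.
Qed.

Lemma quadratic_field (p e : nat) : (p.+1 = 4 * e)%N -> prime p ->
  {K : fieldExtType rat & {w : K | w * w = w - e%:R & \dim {:K} = 2%N}}.
Proof.
move=> pE p_pr.
pose P : {poly rat} := 'X^2 - 'X + e%:R%:P.
have sP : size P = 3%N.
  rewrite /P -addrA size_polyDl size_polyXn // (leq_ltn_trans (size_polyD _ _)) //.
  by rewrite gtn_max size_polyN size_polyX size_polyC; case: eqP.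
have irr : irreducible_poly P.
  apply: cubic_irreducible; rewrite ?sP // => x; apply/negP.
  rewrite /root /P !hornerE => /eqP h.
  have : (0 : rat) < x ^+ 2 - x + e%:R.
    have -> : e%:R = (p%:R + 1) / 4 :> rat by rewrite natr1 pE natrM mulrC mulKf.
    have p0 : (0 : rat) < p%:R by rewrite ltr0n prime_gt0.
    have := sqr_ge0 (x - 1 / 2); rewrite !expr2; nra.
  by rewrite h ltxx.
have [K dimK [w wr _]] := irredp_FAdjoin irr.
exists K, w; last by rewrite dimK sP.
move: wr; rewrite /root /P rmorphD rmorphB /= map_polyXn map_polyX map_polyC /= !hornerE.
rewrite scaler_nat => /eqP h; apply: subr0_eq; rewrite -h; ring.
Qed.

Section NonIsomorphic.
Variables (p e p' e' : nat).
Hypotheses (pE : (p.+1 = 4 * e)%N) (p_pr : prime p).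
Hypotheses (pE' : (p'.+1 = 4 * e')%N) (p_pr' : prime p').
Variables (K K' : fieldExtType rat) (w : K) (w' : K').
Hypotheses (wE : w * w = w - e%:R) (wE' : w' * w' = w' - e'%:R).
Hypotheses (dimK' : \dim {:K'} = 2%N).

(** The valuations at p of the two sides would have different parity. *)
Lemma not_square_ratio (a : rat) : p' != p -> p'%:R * a ^+ 2 != p%:R.
Proof.
move=> ne; apply/eqP => h.
have h2 : (p' * (absz (numq a) ^ 2) = p * (absz (denq a) ^ 2))%N.
  have d0 : (denq a)%:~R != 0 :> rat by rewrite intr_eq0 denq_neq0.
  have /intr_inj /(congr1 absz) : (p'%:Z * (numq a * numq a))%:~R = (p%:Z * (denq a * denq a))%:~R :> rat.
    rewrite !rmorphM /= -[p'%:~R]/(p'%:R) -[p%:~R]/(p%:R) -h.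
    by rewrite -[X in _ * X ^+ 2 * _]divq_num_den; field.
  by rewrite !abszM !mulnn.
have n0 : (0 < absz (numq a))%N.
  rewrite lt0n absz_eq0 numq_eq0; apply/eqP => a0; move: h.
  by rewrite a0 expr0n mulr0 => /esym/eqP; rewrite pnatr_eq0; apply/negP; rewrite -lt0n prime_gt0.
have d0 : (0 < absz (denq a))%N by rewrite lt0n absz_eq0 denq_neq0.
have := congr1 (logn p) h2.
rewrite -!mulnn !lognM ?muln_gt0 ?n0 ?d0 ?prime_gt0 // (logn_prime _ p_pr) (logn_prime _ p_pr') eqxx.
by rewrite [p == p']eq_sym (negbTE ne); clear; lia.
Qed.

(** The image of 2 w - 1 would be a square root of -p in the field of
    discriminant -p'; its trace must vanish, so p / p' would be a square. *)
Lemma not_isomorphic : p' != p -> ~ field_isomorphic K K'.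
Proof.
move=> ne [g _].
have [[a b] zE] := quad_surj pE' p_pr' wE' dimK' (g (2 * w - 1)).
have sq : g (2 * w - 1) * g (2 * w - 1) = - p%:R.
  have pe : p%:R = 4 * e%:R - 1 :> K by rewrite -natrM -pE -natr1 addrK.
  have -> : - p%:R = g (- p%:R) by rewrite rmorphN rmorph_nat.
  rewrite -rmorphM; congr (g _); rewrite pe.
  transitivity (4 * (w * w) - 4 * w + 1); first by ring.
  by rewrite wE; ring.
move: sq; rewrite zE (quadM wE') /=.
have -> : - p%:R = quad w' (- p%:R) 0 by rewrite /quad rmorph0 mul0r addr0 rmorphN rmorph_nat.
move=> h; have [h1 h2] := quad_inj pE' p_pr' wE' h.
have p0 : (0 : rat) < p%:R by rewrite ltr0n prime_gt0.
have /eqP : b * (2 * a + b) = 0 by rewrite -[RHS]h2; ring.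
rewrite mulf_eq0 => /orP[/eqP b0|/eqP ab].
  have := sqr_ge0 a; rewrite expr2; move: h1; rewrite b0; lra.
have bE : b = - (2 * a) by lra.
have := not_square_ratio a ne; apply/negP; rewrite negbK; apply/eqP.
have pe' : p'%:R = 4 * e'%:R - 1 :> rat by rewrite -natrM -pE' -natr1 addrK.
by rewrite pe' -[RHS]opprK -h1 bE; ring.
Qed.

End NonIsomorphic.

Theorem theorem3p6 :
  exists K : nat -> fieldExtType rat,
    (forall n : nat, \dim {: K n} = 2%N /\
       exists O : nf_order (K n), Chow_trivial O) /\
    (forall m n : nat, m <> n -> ~ field_isomorphic (K m) (K n)).
Proof.
have [h hP] := choice infinite_primes_3mod4.
pose g n := iter n h (h 0%N).
have gP n : exists e, (g n).+1 = (4 * e)%N /\ prime (g n).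
  have [m gm] : exists m, g n = h m by case: n => [|n]; [exists 0%N|exists (g n)].
  have [p_pr _ /dvdnP [e eE]] := hP m.
  by exists e; rewrite gm eE mulnC.
have g_mono : {homo g : m n / (m < n)%N}.
  apply: homo_ltn => [? ? ?|n]; first exact: ltn_trans.
  by have [_] := hP (g n).
have [e eP] := choice gP.
pose F n := quadratic_field (eP n).1 (eP n).2.
exists (fun n => projT1 (F n)); split=> [n|m n ne].
  case: (F n) => K [w wE dimK] /=; split=> //.
  have [pE p_pr] := eP n.
  have f0 := split_conductor_gt0 (g n) (e n).
  eexists; apply: (Chow_trivial_quadratic_order pE p_pr wE dimK f0).
    exact: split_conductor_split.
  exact: split_conductor_saturated.
have gne : g n != g m.
  case: (ltngtP m n) ne => // /g_mono lt_g _; first by rewrite gtn_eqF.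
  by rewrite ltn_eqF.
case: (F m) (F n) => K [w wE dimK] [K' [w' wE' dimK']] /=.
have [pE p_pr] := eP m; have [pE' p_pr'] := eP n.
exact: (not_isomorphic pE p_pr pE' p_pr' wE wE' dimK' gne).
Qed.
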